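(* Let $F$ be a number field, $p$ an odd prime, $F_\infty/F$ the cyclotomic $\mathbb{Z}_p$-extension and $\gamma$ a fixed topological generator of $\Gamma=\mathrm{Gal}(F_\infty/F)$. Then multiplication by $(\gamma-1)$ gives an isomorphism of $\Lambda$-modules $$\overline U'_\infty\overset{\sim}{\longrightarrow}(\overline U'_\infty)^{(0)}.$$
   Context: For an abelian group $A$, $\overline A=\varprojlim_m A/A^{p^m}$. $F_\infty=\bigcup_nF_n$, $F_0=F$, $\Lambda=\mathbb{Z}_p[[\Gamma]]$. $U'_n$ is the group of $p$-units of $F_n$ (units outside the places above $p$), $\overline U'_\infty=\varprojlim_n\overline U'_n$ with respect to norm maps. $(\overline U'_\infty)^{(0)}$ is the kernel of the projection $\overline U'_\infty\to\overline U'_0=\overline U'_F$ onto the component of index $0$. The module structure is written additively, so $(\gamma-1)u$ means $u^{\gamma}/u$. *)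

(* Defs.v *)
From HB Require Import structures.
From mathcomp Require Import all_boot all_order all_algebra all_fingroup all_solvable all_field.
From mathcomp Require Import boolp classical_sets.
From mathcomp Require Import ring.

Set Implicit Arguments.
Unset Strict Implicit.
Unset Printing Implicit Defensive.

Import GRing.Theory.
Local Open Scope ring_scope.

Definition is_subring (K : fieldType) (V : set K) : Prop :=
  [/\ V 1, forall x y, V x -> V y -> V (x - y)
    & forall x y, V x -> V y -> V (x * y)].

Definition is_valuation_ring (K : fieldType) (V : set K) : Prop :=
  is_subring V /\ forall x, V x \/ V x^-1.

(* A finite place of a number field is a valuation subring V <> K; since p is in
   V, the place is not above p iff p^-1 is in V. The trivial ring V = K is also
   allowed below, but it imposes no condition on x != 0. *)
Definition is_p_unit (p : nat) (K : fieldType) (x : K) : Prop :=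
  x != 0 /\ forall V : set K,
    is_valuation_ring V -> V p%:R^-1 -> V x /\ V x^-1.

Section Subring.
Variables (K : fieldType) (V : set K).
Hypothesis ringV : is_subring V.

Lemma subring1 : V 1. Proof. by case: ringV. Qed.
Lemma subringB x y : V x -> V y -> V (x - y). Proof. by case: ringV => _ + _; apply. Qed.
Lemma subringM x y : V x -> V y -> V (x * y). Proof. by case: ringV => _ _; apply. Qed.
Lemma subring0 : V 0.
Proof. by rewrite -(subrr 1); apply: subringB; apply: subring1. Qed.
Lemma subringN x : V x -> V (- x).
Proof. by move=> Vx; rewrite -sub0r; apply: subringB => //; apply: subring0. Qed.
Lemma subringD x y : V x -> V y -> V (x + y).
Proof. by move=> Vx Vy; rewrite -(opprK y); apply/subringB/subringN. Qed.
Lemma subring_sum I (r : seq I) (P : pred I) F :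
  (forall i, P i -> V (F i)) -> V (\sum_(i <- r | P i) F i).
Proof. by move=> VF; elim/big_rec: _ => [|i x Pi Vx]; [apply: subring0|apply/subringD/Vx/VF]. Qed.

Definition polyin (p : {poly K}) := forall i, V p`_i.

Lemma polyinC c : V c -> polyin c%:P.
Proof. by move=> Vc i; rewrite coefC; case: ifP => _ //; apply: subring0. Qed.
Lemma polyinB p q : polyin p -> polyin q -> polyin (p - q).
Proof. by move=> Vp Vq i; rewrite coefB; apply: subringB. Qed.
Lemma polyinM p q : polyin p -> polyin q -> polyin (p * q).
Proof. by move=> Vp Vq i; rewrite coefM; apply: subring_sum => j _; apply: subringM. Qed.
Lemma polyinX : polyin 'X.
Proof. by move=> i; rewrite coefX; case: eqP => _; [apply: subring1|apply: subring0]. Qed.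

Lemma adjoin_subring x : is_subring [set p.[x] | p in polyin]%classic.
Proof.
split; first by exists 1%:P; [apply/polyinC/subring1 | rewrite hornerC].
  by move=> _ _ [p Vp <-] [q Vq <-]; exists (p - q); [apply: polyinB | rewrite hornerD hornerN].
by move=> _ _ [p Vp <-] [q Vq <-]; exists (p * q); [apply: polyinM | rewrite hornerM].
Qed.

Lemma adjoin_sub x : (V `<=` [set p.[x] | p in polyin])%classic.
Proof. by move=> c Vc; exists c%:P; [apply: polyinC | rewrite hornerC]. Qed.

Lemma adjoin_gen x : ([set p.[x] | p in polyin])%classic x.
Proof. by exists 'X; [apply: polyinX | rewrite hornerX]. Qed.

End Subring.

Section Extension.
Variables (K : fieldType) (y : K) (V : set K).
Hypotheses (ringV : is_subring V) (Vyi : V y^-1) (V'y : ~ V y).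
Hypothesis maxV : forall W : set K, is_subring W -> (V `<=` W)%classic -> ~ W y -> (W `<=` V)%classic.

Let y0 : y != 0.
Proof. by apply/eqP => yE; apply: V'y; rewrite yE; apply: subring0. Qed.

(* elements congruent to 1 modulo y^-1 are invertible *)
Let unit1 b : V b -> V (1 - y^-1 * b)^-1.
Proof.
move=> Vb; set s := 1 - _.
have Vs : V s by apply: (subringB ringV (subring1 ringV)); apply: (subringM ringV).
suff : ~ [set p.[s^-1] | p in polyin V]%classic y.
  move=> /(maxV (adjoin_subring ringV _) (adjoin_sub ringV _)); apply.
  exact: adjoin_gen.
case=> p Vp py.
have s0 : s != 0.
  apply/eqP => /subr0_eq yb; apply: V'y.
  by rewrite -(mulr1 y) yb mulrA mulfV // mul1r.
have Vsn n : V (s ^+ n).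
  by elim: n => [|n IH]; [apply: subring1 | rewrite exprS; apply: subringM].
have [k [c Vc yE]] : exists k, exists2 c, V c & y = c / s ^+ k.
  exists (size p); exists (\sum_(i < size p) p`_i * s ^+ (size p - i)).
    by apply: subring_sum => // i _; apply: subringM.
  rewrite -py horner_coef mulr_suml; apply: eq_bigr => i _.
  rewrite -mulrA exprVn; congr (_ * _).
  have -> : s ^+ size p = s ^+ (size p - i) * s ^+ i.
    by rewrite -exprD subnK // ltnW.
  by rewrite invfM mulrA mulfV ?expf_neq0 // mul1r.
have [d Vd sE] : exists2 d, V d & s ^+ k = 1 - y^-1 * d.
  elim: k {yE} => [|k [d Vd IH]].
    by exists 0; [apply: subring0 | rewrite mulr0 subr0].
  exists (b + d * s); first by apply: subringD => //; apply: subringM.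
  by rewrite exprSr IH /s; ring.
apply: V'y.
have cE : c = y * s ^+ k by rewrite yE mulfVK ?expf_neq0.
have -> : y = c + d.
  by rewrite cE sE mulrBr mulr1 mulrA mulfV // mul1r subrK.
exact: subringD.
Qed.

Let reduce x n m (p q : {poly K}) : x != 0 -> (m <= n)%N -> polyin V p -> polyin V q ->
  (size p <= n.+1)%N -> (size q <= m.+1)%N -> y = p.[x] -> y = q.[x^-1] ->
  exists p' : {poly K}, [/\ polyin V p', (size p' <= n)%N & y = p'.[x]].
Proof.
move=> x0 mn Vp Vq sp sq yp yq.
have q1 : 1 - y^-1 * q`_0 = y^-1 * \sum_(1 <= j < m.+1) q`_j * x^-1 ^+ j.
  rewrite -{1}(mulVf y0) -mulrBr; congr (_ * _).
  rewrite {1}yq (horner_coef_wide _ sq) -(big_mkord xpredT (fun j => q`_j * x^-1 ^+ j)).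
  by rewrite big_nat_recl // expr0 mulr1 addrAC subrr add0r big_add1.
set u := 1 - _ in q1.
have u0 : u != 0.
  rewrite /u; apply/eqP => /subr0_eq yb; apply: V'y.
  by rewrite -(mulr1 y) yb mulrA mulfV // mul1r.
have lead : p`_n * x ^+ n
   = \sum_(j < n) (if (n - j <= m)%N then p`_n * y^-1 * u^-1 * q`_(n - j) else 0) * x ^+ j.
  have -> : p`_n * x ^+ n = p`_n * x ^+ n * u^-1 * u by rewrite mulfVK.
  rewrite {2}q1 (reindex_inj rev_ord_inj) /=.
  rewrite big_add1 /= big_mkord mulrA.
  rewrite (big_ord_widen _ (fun i => q`_i.+1 * x^-1 ^+ i.+1) mn) big_mkcond mulr_sumr.
  apply: eq_bigr => i _; have := ltn_ord i => ltin.
  rewrite subKn //; case: ifP => _; last by rewrite mulr0 mul0r.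
  have : x ^+ n * x^-1 ^+ i.+1 = x ^+ (n - i.+1).
    by rewrite exprVn -{1}(subnK ltin) exprD mulfK ?expf_neq0.
  move=> <-; ring.
exists (\poly_(j < n) (p`_j + (if (n - j <= m)%N then p`_n * y^-1 * u^-1 * q`_(n - j) else 0))).
split; last 1 first.
- rewrite horner_poly {1}yp (horner_coef_wide _ sp) big_ord_recr /= lead -big_split /=.
  by apply: eq_bigr => i _; rewrite mulrDl.
- move=> j; rewrite coef_poly; case: ifP => _; last exact: subring0.
  apply: subringD => //; case: ifP => _; last exact: subring0.
  by do ![apply: (subringM ringV)] => //; apply: unit1.
- exact: size_poly.
Qed.

Lemma max_valuation : is_valuation_ring V.
Proof.
split=> // x; have [Vx|V'x] := pselect (V x); first by left.
have [Vxi|V'xi] := pselect (V x^-1); [by right|exfalso].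
have x0 : x != 0 by apply/eqP => xE; apply: V'x; rewrite xE; apply: subring0.
have adj z : ~ V z -> exists2 p, polyin V p & y = p.[z].
  move=> V'z; have [[p Vp <-]|W'y] := pselect ([set p.[z] | p in polyin V]%classic y).
    by exists p.
  by case: V'z; apply: (maxV (adjoin_subring ringV _) (adjoin_sub ringV _) W'y); apply: adjoin_gen.
have [p Vp py] := adj _ V'x; have [q Vq qy] := adj _ V'xi.
have [N] := ubnP (size p + size q)%N.
elim: N => // N IH in p q Vp Vq py qy *; rewrite ltnS => le.
have pos r z : polyin V r -> y = r.[z] -> (0 < size r)%N.
  move=> _ yr; rewrite lt0n size_poly_eq0; apply/eqP => r0.
  by move: y0; rewrite yr r0 horner0 eqxx.
have pp := pos _ _ Vp py; have qp := pos _ _ Vq qy.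
have [qlp|plq] := leqP (size q) (size p).
  have le1 : ((size q).-1 <= (size p).-1)%N by rewrite -ltnS !prednK.
  have [p' [Vp' sp' yp']] := reduce x0 le1 Vp Vq (leqSpred _) (leqSpred _) py qy.
  apply: (IH p' q) => //; apply: leq_trans le.
  by rewrite ltn_add2r -(prednK pp) ltnS.
have le1 : ((size p).-1 <= (size q).-1)%N by rewrite -ltnS !prednK // ltnW.
have xi0 : x^-1 != 0 by rewrite invr_eq0.
have py' : y = p.[x^-1^-1] by rewrite invrK.
have [q' [Vq' sq' yq']] := reduce xi0 le1 Vq Vp (leqSpred _) (leqSpred _) qy py'.
apply: (IH p q') => //; apply: leq_trans le.
by rewrite ltn_add2l -(prednK qp) ltnS.
Qed.

End Extension.

Lemma valuation_extension (K : fieldType) (R : set K) (y : K) :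
    is_subring R -> R y^-1 -> ~ R y ->
  exists V : set K, [/\ is_valuation_ring V, (R `<=` V)%classic & ~ V y].
Proof.
move=> ringR Ryi R'y.
pose P : set (set K) := fun A => A = set0 \/ [/\ is_subring A, (R `<=` A)%classic & ~ A y].
have [|V [PV maxV]] := @Zorn_bigcup K P.
  move=> F FP Ftot.
  have [[A FA [a Aa]]|F0] := pselect (exists2 A, F A & exists a, A a); last first.
    left; apply/seteqP; split=> // a [A FA Aa]; case: F0; exists A => //; by exists a.
  have FP' B b : F B -> B b -> [/\ is_subring B, (R `<=` B)%classic & ~ B y].
    by move=> FB Bb; case: (FP _ FB) => // B0; rewrite B0 in Bb.
  have two x z : (\bigcup_(X in F) X)%classic x -> (\bigcup_(X in F) X)%classic z ->
     exists B, [/\ F B, B x & B z].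
    move=> [B FB Bx] [C FC Cz]; case: (Ftot _ _ FB FC) => sub; [exists C|exists B]; split=> //; exact: sub.
  right; split.
  - split.
    + exists A => //; by have [rA _ _] := FP' _ _ FA Aa; apply: subring1.
    + move=> x z Ux Uz; have [B [FB Bx Bz]] := two _ _ Ux Uz.
      by exists B => //; have [rB _ _] := FP' _ _ FB Bx; apply: subringB.
    + move=> x z Ux Uz; have [B [FB Bx Bz]] := two _ _ Ux Uz.
      by exists B => //; have [rB _ _] := FP' _ _ FB Bx; apply: subringM.
  - by move=> r Rr; exists A => //; have [_ + _] := FP' _ _ FA Aa; apply.
  - by case=> B FB By; have [_ _] := FP' _ _ FB By.
case: PV => [V0|[ringV RV V'y]].
  case: (maxV R); last by right; split.
  rewrite V0; split=> // /(_ 1) /=; apply=> //; exact: subring1.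
exists V; split=> //.
apply: max_valuation ringV _ V'y _; first exact: RV.
move=> W ringW VW W'y x Wx; have [//|V'x] := pselect (V x).
case: (maxV W); last by right; split=> // r /RV /VW.
by split=> // /(_ x Wx).
Qed.

Section PUnits.
Variable p : nat.

Lemma is_p_unit1 (K : fieldType) : is_p_unit p (1 : K).
Proof.
split; first exact: oner_neq0.
by move=> V [ringV _] _; rewrite invr1; split; apply: subring1.
Qed.

Lemma is_p_unitM (K : fieldType) (x y : K) :
  is_p_unit p x -> is_p_unit p y -> is_p_unit p (x * y).
Proof.
move=> [x0 Ux] [y0 Uy]; split; first exact: mulf_neq0.
move=> V valV Vp; have [ringV _] := valV.
have [Vx Vxi] := Ux V valV Vp; have [Vy Vyi] := Uy V valV Vp.
by rewrite invfM; split; apply: subringM.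
Qed.

Lemma is_p_unitV (K : fieldType) (x : K) : is_p_unit p x -> is_p_unit p x^-1.
Proof.
move=> [x0 Ux]; split; first by rewrite invr_eq0.
by move=> V valV Vp; rewrite invrK; have [] := Ux V valV Vp.
Qed.

Lemma is_p_unit_rmorph (K M : fieldType) (i : {rmorphism K -> M}) (x : K) :
  is_p_unit p (i x) <-> is_p_unit p x.
Proof.
rewrite /is_p_unit fmorph_eq0; split=> -[x0 Ux]; split=> // V valV Vp; last first.
  rewrite -fmorphV; apply: (Ux [set z | V (i z)]%classic); last first.
    by rewrite /= fmorphV rmorph_nat.
  have [ringV totV] := valV; split; last by move=> z; rewrite /= fmorphV.
  split=> /= [|z t Vz Vt|z t Vz Vt]; first by rewrite rmorph1; apply: subring1.
    by rewrite rmorphB; apply: subringB.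
  by rewrite rmorphM; apply: subringM.
have [ringV totV] := valV.
have ringiV : is_subring [set i z | z in V]%classic.
  split; first by exists 1; [apply: subring1 | rewrite rmorph1].
    move=> _ _ [z Vz <-] [t Vt <-]; exists (z - t); [exact: subringB | exact: rmorphB].
  by move=> _ _ [z Vz <-] [t Vt <-]; exists (z * t); [exact: subringM | exact: rmorphM].
have key z : is_p_unit p (i z) -> V z.
  move=> [_ Uz]; case: (totV z) => // Vzi.
  have [//|V'z] := pselect (V z).
  have [|[t Vt /fmorph_inj tz]|W [valW VW W'z]] := @valuation_extension M _ (i z) ringiV.
  - by exists z^-1 => //; rewrite fmorphV.
  - by rewrite -tz in V'z.
  have [|//] := Uz W valW.
  by apply: VW; exists p%:R^-1 => //; rewrite fmorphV rmorph_nat.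
have Uix : is_p_unit p (i x) by split; [rewrite fmorph_eq0 | apply: Ux].
split; apply: key => //; rewrite fmorphV; exact: is_p_unitV.
Qed.

Record p_units (K : fieldType) := PUnit {
  p_unit_val :> K;
  _ : `[< is_p_unit p p_unit_val >] }.

HB.instance Definition _ K := [isSub for @p_unit_val K].
HB.instance Definition _ K := [Choice of p_units K by <:].

Section Zmod.
Variable K : fieldType.
Implicit Types x y : p_units K.

Lemma p_unitP x : is_p_unit p (p_unit_val x).
Proof. by case: x => x Ux; exact: (asboolW Ux). Qed.

Definition mk_p_unit (x : K) (Ux : is_p_unit p x) : p_units K := PUnit (asboolT Ux).

Definition p_unit_one := mk_p_unit (is_p_unit1 K).
Definition p_unit_inv x := mk_p_unit (is_p_unitV (p_unitP x)).
Definition p_unit_mul x y := mk_p_unit (is_p_unitM (p_unitP x) (p_unitP y)).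

Fact p_unit_mulA : associative p_unit_mul.
Proof. by move=> x y z; apply/val_inj/mulrA. Qed.
Fact p_unit_mulC : commutative p_unit_mul.
Proof. by move=> x y; apply/val_inj/mulrC. Qed.
Fact p_unit_mul1 : left_id p_unit_one p_unit_mul.
Proof. by move=> x; apply/val_inj/mul1r. Qed.
Fact p_unit_mulV : left_inverse p_unit_one p_unit_inv p_unit_mul.
Proof. by move=> x; apply/val_inj/mulVf; case: (p_unitP x). Qed.

(* The multiplicative group of p-units, written additively. *)
HB.instance Definition _ := GRing.isZmodule.Build (p_units K)
  p_unit_mulA p_unit_mulC p_unit_mul1 p_unit_mulV.

Lemma p_units0E : p_unit_val (0 : p_units K) = 1. Proof. by []. Qed.
Lemma p_unitsDE x y : p_unit_val (x + y) = p_unit_val x * p_unit_val y.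
Proof. by []. Qed.
Lemma p_unitsNE x : p_unit_val (- x) = (p_unit_val x)^-1. Proof. by []. Qed.

End Zmod.

Definition p_units_map (K M : fieldType) (i : {rmorphism K -> M}) (x : p_units K) :
    p_units M :=
  mk_p_unit ((is_p_unit_rmorph i (p_unit_val x)).2 (p_unitP x)).

Fact p_units_map_additive K M i : zmod_morphism (@p_units_map K M i).
Proof. by move=> x y; apply/val_inj; rewrite /= rmorphM fmorphV. Qed.

HB.instance Definition _ K M i := GRing.isZmodMorphism.Build (p_units K) (p_units M)
  (@p_units_map K M i) (@p_units_map_additive K M i).

End PUnits.
Arguments p_units_map p {K M} i x.

Section Norm.
Variables (F : fieldExtType rat) (L M : splittingFieldType F) (i : 'AHom(L, M)).

(* The norm of M / i(L), a Galois extension; it lies in i(L) (rel_normE) and is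
   transported back to L along i. *)
Definition rel_norm (x : M) : L := (i^-1)%VF (galNorm (limg i) {:M} x).

Lemma galois_ahom : galois (limg i) {:M}.
Proof.
rewrite /galois subvf normalFieldf andbT; apply/separableP => x _.
apply: (@pcharf0_separable F M [aspace of limg i]) => q.
by rewrite (pchar_lalg M) (pchar_lalg F) Num.Theory.pchar_num.
Qed.

Lemma rel_normE x : i (rel_norm x) = galNorm (limg i) {:M} x.
Proof.
rewrite limg_lfunVK //.
exact: (@mem_galNorm F M [aspace of limg i] [aspace of {:M}] _ galois_ahom (memvf _)).
Qed.

Variable p : nat.

Lemma is_p_unit_norm x : is_p_unit p x -> is_p_unit p (rel_norm x).
Proof.
move=> Ux; apply: (is_p_unit_rmorph p i (rel_norm x)).1; rewrite [X in is_p_unit p X] rel_normE /galNorm.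
elim/big_rec: _ => [|g y _ Uy]; first exact: is_p_unit1.
by apply: is_p_unitM => //; apply: (is_p_unit_rmorph p (gal_repr g) x).2.
Qed.

Definition p_units_norm (x : p_units p M) : p_units p L :=
  mk_p_unit (is_p_unit_norm (p_unitP x)).

Fact p_units_norm_additive : zmod_morphism p_units_norm.
Proof.
move=> x y; apply/val_inj => /=; apply: (@fmorph_inj _ _ i) => /=.
rewrite /= rmorphM fmorphV.
have E z : (i : {rmorphism L -> M}) (rel_norm z) = galNorm (limg i) {:M} z by apply: rel_normE.
by rewrite !E galNormM galNormV.
Qed.

HB.instance Definition _ := GRing.isZmodMorphism.Build (p_units p M) (p_units p L)
  p_units_norm p_units_norm_additive.

End Norm.
Arguments p_units_norm {F L M} i p x.

Section Restriction.
Variables (F : fieldType) (L : splittingFieldType F) (M : fieldType).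
Implicit Types i j : {rmorphism L -> M}.

Lemma gal_restr_exists i j : (forall a : F, i a%:A = j a%:A) ->
  exists s : gal_of {:L}, forall x, i (s x) = j x.
Proof.
move=> ij.
have ex x : exists y, i y = j x.
  have [r /eqP minE] := splitting_field_normal 1%AS x.
  have := root_minPoly 1%AS x; rewrite -(fmorph_root j).
  suff -> : map_poly j (minPoly 1 x) = map_poly i (minPoly 1 x).
    rewrite minE rmorph_prod /= (eq_bigr (fun y => 'X - (i y)%:P)); last first.
      by move=> y _; rewrite map_polyXsubC.
    by rewrite -(big_map i xpredT (fun y => 'X - y%:P)) root_prod_XsubC => /mapP[y _ ->]; exists y.
  apply/polyP => k; rewrite !coef_map /=.
  have /polyOverP/(_ k)/vlineP[a ->] := minPolyOver 1%AS x.
  by rewrite ij.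
have [f fE] := choice ex.
have fF a : f a%:A = a%:A by apply: (fmorph_inj i); rewrite fE ij.
have fB : zmod_morphism f by move=> x y; apply: (fmorph_inj i); rewrite rmorphB !fE rmorphB.
have fM : monoid_morphism f.
  split; first by apply: (fmorph_inj i); rewrite fE !rmorph1.
  by move=> x y; apply: (fmorph_inj i); rewrite rmorphM !fE rmorphM.
have fZ : scalable f by move=> a x; rewrite -mulr_algl fM.2 fF mulr_algl.
pose fL : {lrmorphism L -> L} := HB.pack f (GRing.isZmodMorphism.Build L L f fB)
  (GRing.isMonoidMorphism.Build L L f fM) (GRing.isScalable.Build F L L *:%R f fZ).
have hom : ahom_in {:L} (linfun fL) by exact: linfun_is_ahom.
exists (gal {:L} (AHom hom)) => x.
rewrite galK ?memvf ?subvf // -fE; congr (i _); exact: (lfunE fL x).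
Qed.

Lemma gal_restr_unique i (s t : gal_of {:L}) : (forall x, i (s x) = i (t x)) -> s = t.
Proof. by move=> st; apply/eqP/gal_eqP => x _; apply: (fmorph_inj i). Qed.

End Restriction.

Section ProjectiveLimit.
Variables (A : nat -> zmodType) (f : forall n, {additive A n.+1 -> A n}).

Record plim := PLim {
  plim_val :> forall n, A n;
  plimP : forall n, f n (plim_val n.+1) = plim_val n }.

Lemma plim_inj (x y : plim) : (forall n, x n = y n) -> x = y.
Proof.
case: x y => x xP [y yP] /= xy; have {}xy : x = y by apply/functional_extensionality_dep.
by subst y; congr PLim; apply: Prop_irrelevance.
Qed.

HB.instance Definition _ := gen_eqMixin plim.
HB.instance Definition _ := gen_choiceMixin plim.

Definition plim_zero : plim := PLim (fun n => raddf0 (f n)).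

Fact plim_opp_subproof (x : plim) n : f n (- x n.+1) = - x n.
Proof. by rewrite raddfN plimP. Qed.
Definition plim_opp x : plim := PLim (plim_opp_subproof x).

Fact plim_add_subproof (x y : plim) n : f n (x n.+1 + y n.+1) = x n + y n.
Proof. by rewrite raddfD !plimP. Qed.
Definition plim_add x y : plim := PLim (plim_add_subproof x y).

Fact plim_addA : associative plim_add.
Proof. by move=> x y z; apply: plim_inj => n /=; rewrite addrA. Qed.
Fact plim_addC : commutative plim_add.
Proof. by move=> x y; apply: plim_inj => n /=; rewrite addrC. Qed.
Fact plim_add0 : left_id plim_zero plim_add.
Proof. by move=> x; apply: plim_inj => n /=; rewrite add0r. Qed.
Fact plim_addN : left_inverse plim_zero plim_opp plim_add.
Proof. by move=> x; apply: plim_inj => n /=; rewrite addNr. Qed.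

HB.instance Definition _ := GRing.isZmodule.Build plim
  plim_addA plim_addC plim_add0 plim_addN.

Definition plim_proj n (x : plim) : A n := x n.

Fact plim_proj_additive n : zmod_morphism (plim_proj n).
Proof. by []. Qed.

HB.instance Definition _ n := GRing.isZmodMorphism.Build plim (A n)
  (plim_proj n) (plim_proj_additive n).

End ProjectiveLimit.

Definition multiples (p : nat) (A : zmodType) (m : nat) : {pred A} :=
  fun x => `[< exists y, x = y *+ p ^ m >].
Arguments multiples : clear implicits.

Fact multiples_zmod_closed p A m : zmod_closed (multiples p A m).
Proof.
split; first by apply/asboolP; exists 0; rewrite mul0rn.
move=> x y /asboolP[x' ->] /asboolP[y' ->].
by apply/asboolP; exists (x' - y'); rewrite mulrnBl.
Qed.

HB.instance Definition _ p A m := GRing.isZmodClosed.Build A (multiples p A m)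
  (multiples_zmod_closed p A m).

Notation modpow p A m := {ideal_quot multiples p A m}.

Section ModpMap.
Variables (p : nat) (A B : zmodType) (h : {additive A -> B}).
Local Open Scope quotient_scope.

Definition modpow_map m n (x : modpow p A m) : modpow p B n := \pi_(modpow p B n) (h (generic_quotient.repr x)).

Lemma modpow_mapE m n (x : A) : (n <= m)%N ->
  modpow_map n (\pi_(modpow p A m) x) = \pi_(modpow p B n) (h x).
Proof.
move=> nm; apply/eqP; rewrite -Quotient.idealrBE -raddfB.
have /asboolP[y ->] : generic_quotient.repr (\pi_(modpow p A m) x) - x \in multiples p A m.
  by rewrite Quotient.idealrBE reprK.
rewrite -(subnK nm) expnD mulrnA; apply/asboolP; exists (h (y *+ p ^ (m - n))).
by rewrite !raddfMn.
Qed.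

Lemma modpow_mapB m n : (n <= m)%N -> zmod_morphism (@modpow_map m n).
Proof.
by move=> nm; elim/quotW=> x; elim/quotW=> y; rewrite -raddfB !modpow_mapE //= !raddfB.
Qed.
End ModpMap.

Section ModpTransition.
Variables (p : nat) (A : zmodType) (m : nat).

Definition modpow_trans : modpow p A m.+1 -> modpow p A m := @modpow_map p A A idfun m.+1 m.

Fact modpow_trans_additive : zmod_morphism modpow_trans.
Proof. exact: modpow_mapB. Qed.
HB.instance Definition _ := GRing.isZmodMorphism.Build (modpow p A m.+1) (modpow p A m)
  modpow_trans modpow_trans_additive.

Lemma modpow_trans_pi (x : A) :
  modpow_trans (\pi_(modpow p A m.+1)%qT x) = (\pi_(modpow p A m) x)%qT.
Proof. exact: modpow_mapE. Qed.

Lemma modpow_torsion (x : modpow p A m) : x *+ p ^ m = 0.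
Proof.
elim/quotW: x => x; rewrite -raddfMn -[RHS](raddf0 \pi_(modpow p A m)%qT).
by apply/eqP; rewrite -Quotient.idealrBE subr0; apply/asboolP; exists x.
Qed.

Lemma modpow_mulrz_mod (x : modpow p A m) (k : int) : x *~ (k %% (p ^ m)%N)%Z = x *~ k.
Proof.
rewrite /modz mulrzDr mulrNz (mulrC (divz _ _)) mulrzA.
by rewrite -pmulrn modpow_torsion mul0rz subr0.
Qed.
End ModpTransition.
Arguments modpow_trans : clear implicits.

(* lim_m A / p^m A *)
Definition completion (p : nat) (A : zmodType) : Type :=
  plim (A := fun m => modpow p A m) (fun m => modpow_trans p A m).

HB.instance Definition _ p A := GRing.Zmodule.on (completion p A).

Section CompletionMap.
Variables (p : nat) (A B : zmodType) (h : {additive A -> B}).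

Fact completion_map_subproof (x : completion p A) m :
  modpow_trans p B m (modpow_map h m.+1 (x m.+1)) = modpow_map h m (x m).
Proof.
rewrite -(plimP x m); elim/quotW: (x m.+1) => y /=.
by rewrite modpow_trans_pi !modpow_mapE // modpow_trans_pi.
Qed.

Definition completion_map (x : completion p A) : completion p B :=
  PLim (A := fun m => modpow p B m) (f := fun m => modpow_trans p B m)
    (completion_map_subproof x).

Fact completion_map_additive : zmod_morphism completion_map.
Proof. by move=> x y; apply: plim_inj => m /=; rewrite modpow_mapB. Qed.

HB.instance Definition _ := GRing.isZmodMorphism.Build
  (completion p A) (completion p B) completion_map completion_map_additive.
End CompletionMap.

Lemma completion_map_comp p (A B C : zmodType) (h : {additive A -> B})
    (k : {additive B -> C}) (l : {additive A -> C}) :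
  (forall x, k (h x) = l x) ->
  forall x : completion p A, completion_map k (completion_map h x) = completion_map l x.
Proof.
move=> khl x; apply: plim_inj => m /=; elim/quotW: (x m) => y.
by rewrite (modpow_mapE _ h) // (modpow_mapE _ k) // (modpow_mapE _ l) // khl.
Qed.

Lemma completion_map_id p (A : zmodType) (h : {additive A -> A}) :
  (forall x, h x = x) -> forall x : completion p A, completion_map h x = x.
Proof.
move=> hE x; apply: plim_inj => m /=; elim/quotW: (x m) => y.
by rewrite (modpow_mapE _ h) // hE.
Qed.

Section PadicIntegers.
Variable p : nat.

(* An element of lim_m Z/p^m, each class being represented by its residue modulo
   p ^ m; note that the condition forces this normal form. *)
Record padic_int := MkPadicInt {
  padic_int_res :> nat -> int;
  padic_int_resP : forall m, (padic_int_res m.+1 %% (p ^ m)%N)%Z = padic_int_res m }.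

Lemma padic_int_inj (a b : padic_int) : (forall m, a m = b m) -> a = b.
Proof.
case: a b => a aP [b bP] /= ab; have {}ab : a = b by apply: funext.
by subst b; congr MkPadicInt; apply: Prop_irrelevance.
Qed.

Lemma modz_pow_trans (k : int) m :
  ((k %% (p ^ m.+1)%N)%Z %% (p ^ m)%N)%Z = (k %% (p ^ m)%N)%Z.
Proof.
by rewrite -(modzMDl ((k %/ (p ^ m.+1)%N)%Z * p)) -mulrA -PoszM -expnS -divz_eq.
Qed.

Lemma padic_int_modz (a : padic_int) m : (a m %% (p ^ m)%N)%Z = a m.
Proof. by rewrite -padic_int_resP modz_mod. Qed.

HB.instance Definition _ := gen_eqMixin padic_int.
HB.instance Definition _ := gen_choiceMixin padic_int.

Definition padic_int_of_int (k : int) : padic_int :=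
  MkPadicInt (modz_pow_trans k).

Fact padic_int_opp_subproof (a : padic_int) m :
  ((- a m.+1 %% (p ^ m.+1)%N)%Z %% (p ^ m)%N)%Z = (- a m %% (p ^ m)%N)%Z.
Proof. by rewrite modz_pow_trans -(padic_int_resP a m); apply/esym/modzNm. Qed.
Definition padic_int_opp a := MkPadicInt (padic_int_opp_subproof a).

Fact padic_int_add_subproof (a b : padic_int) m :
  (((a m.+1 + b m.+1) %% (p ^ m.+1)%N)%Z %% (p ^ m)%N)%Z
    = ((a m + b m) %% (p ^ m)%N)%Z.
Proof. by rewrite modz_pow_trans -(padic_int_resP a m) -(padic_int_resP b m) modzDm. Qed.
Definition padic_int_add a b := MkPadicInt (padic_int_add_subproof a b).

Fact padic_int_mul_subproof (a b : padic_int) m :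
  (((a m.+1 * b m.+1) %% (p ^ m.+1)%N)%Z %% (p ^ m)%N)%Z
    = ((a m * b m) %% (p ^ m)%N)%Z.
Proof. by rewrite modz_pow_trans -(padic_int_resP a m) -(padic_int_resP b m) modzMm. Qed.
Definition padic_int_mul a b := MkPadicInt (padic_int_mul_subproof a b).

Fact padic_int_addA : associative padic_int_add.
Proof. by move=> a b c; apply: padic_int_inj => m /=; rewrite modzDml modzDmr addrA. Qed.
Fact padic_int_addC : commutative padic_int_add.
Proof. by move=> a b; apply: padic_int_inj => m /=; rewrite addrC. Qed.
Fact padic_int_add0 : left_id (padic_int_of_int 0) padic_int_add.
Proof. by move=> a; apply: padic_int_inj => m /=; rewrite modzDml add0r padic_int_modz. Qed.
Fact padic_int_addN : left_inverse (padic_int_of_int 0) padic_int_opp padic_int_add.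
Proof. by move=> a; apply: padic_int_inj => m /=; rewrite modzDml addNr. Qed.
HB.instance Definition _ := GRing.isZmodule.Build padic_int padic_int_addA padic_int_addC padic_int_add0 padic_int_addN.

Fact padic_int_mulA : associative padic_int_mul.
Proof. by move=> a b c; apply: padic_int_inj => m /=; rewrite modzMml modzMmr mulrA. Qed.
Fact padic_int_mulC : commutative padic_int_mul.
Proof. by move=> a b; apply: padic_int_inj => m /=; rewrite mulrC. Qed.
Fact padic_int_mul1 : left_id (padic_int_of_int 1) padic_int_mul.
Proof. by move=> a; apply: padic_int_inj => m /=; rewrite modzMml mul1r padic_int_modz. Qed.
Fact padic_int_mulD : left_distributive padic_int_mul +%R.
Proof. by move=> a b c; apply: padic_int_inj => m /=; rewrite modzMml modzDm mulrDl. Qed.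
HB.instance Definition _ := GRing.Zmodule_isComPzRing.Build padic_int
  padic_int_mulA padic_int_mulC padic_int_mul1 padic_int_mulD.

Section Scale.
Variable A : zmodType.

Fact padic_int_scale_subproof (a : padic_int) (x : completion p A) m :
  modpow_trans p A m (x m.+1 *~ a m.+1) = x m *~ a m.
Proof. by rewrite raddfMz (plimP x m) -modpow_mulrz_mod padic_int_resP. Qed.

Definition padic_int_scale (a : padic_int) (x : completion p A) : completion p A :=
  PLim (A := fun m => modpow p A m) (f := fun m => modpow_trans p A m) (padic_int_scale_subproof a x).

Fact padic_int_scaleA (a b : padic_int) (x : completion p A) :
  padic_int_scale a (padic_int_scale b x) = padic_int_scale (a * b) x.
Proof. by apply: plim_inj => m /=; rewrite modpow_mulrz_mod -mulrzA mulrC. Qed.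
Fact padic_int_scale1 : left_id (1 : padic_int) padic_int_scale.
Proof. by move=> x; apply: plim_inj => m /=; rewrite modpow_mulrz_mod. Qed.
Fact padic_int_scaleDr : right_distributive padic_int_scale +%R.
Proof. by move=> a x y; apply: plim_inj => m /=; rewrite mulrzDl. Qed.
Fact padic_int_scaleDl (x : completion p A) : {morph (padic_int_scale^~ x) : a b / a + b >-> a + b}.
Proof. by move=> a b; apply: plim_inj => m /=; rewrite modpow_mulrz_mod mulrzDr. Qed.

HB.instance Definition _ := GRing.Zmodule_isLmodule.Build padic_int (completion p A)
  padic_int_scaleA padic_int_scale1 padic_int_scaleDr padic_int_scaleDl.
End Scale.
End PadicIntegers.

Fact completion_map_scalable p (A B : zmodType) (h : {additive A -> B}) :
  scalable (@completion_map p A B h).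
Proof.
move=> a x; apply: plim_inj => m /=.
elim/quotW: (x m) => y; rewrite -raddfMz !modpow_mapE //.
by rewrite !raddfMz.
Qed.
HB.instance Definition _ p A B h := GRing.isScalable.Build (padic_int p)
  (completion p A) (completion p B) *:%R (@completion_map p A B h)
  (completion_map_scalable h).

Section GalRestriction.
Variables (F : fieldType) (L : splittingFieldType F) (M : fieldType).
Variables i j : {rmorphism L -> M}.

(* When i and j agree on F, this is the s with i \o s = j: L is normal over F. *)
Definition gal_restr : gal_of {:L} :=
  xget 1%g [set s : gal_of {:L} | forall x, i (s x) = j x]%classic.

Hypothesis ij : forall a : F, i a%:A = j a%:A.

Lemma gal_restrE x : i (gal_restr x) = j x.
Proof.
rewrite /gal_restr; case: xgetP => [s _ /(_ x) //|no].
by have [s sE] := gal_restr_exists ij; case: (no s).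
Qed.

Lemma gal_restr_eq (s : gal_of {:L}) : (forall x, i (s x) = j x) -> gal_restr = s.
Proof. by move=> sE; apply: (@gal_restr_unique F L M i) => x; rewrite gal_restrE sE. Qed.
End GalRestriction.

Definition group_ring (R : pzRingType) (gT : finGroupType) : Type := {ffun gT -> R}.

HB.instance Definition _ R gT := GRing.Zmodule.on (group_ring R gT).

Section GroupRing.
Variables (R : pzRingType) (gT : finGroupType).
Implicit Types f g h : group_ring R gT.

Definition gr_elt (x : gT) : group_ring R gT := [ffun y => (y == x)%:R].
Definition gr_mul f g : group_ring R gT :=
  [ffun x => \sum_y f y * g (y^-1 * x)%g].

Lemma gr_addE f g x : (f + g) x = f x + g x. Proof. exact: ffunE. Qed.

Fact gr_mulA : associative gr_mul.
Proof.
move=> f g h; apply/ffunP => x; rewrite !ffunE.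
under eq_bigr => y _ do rewrite ffunE mulr_sumr.
under [RHS]eq_bigr => z _ do rewrite ffunE mulr_suml.
rewrite [RHS]exchange_big /=; apply: eq_bigr => y _.
rewrite (reindex_inj (mulgI y^-1)%g); apply: eq_bigr => z _.
by rewrite mulrA invMg invgK -mulgA mulKVg.
Qed.

Fact gr_mul1l : left_id (gr_elt 1) gr_mul.
Proof.
move=> f; apply/ffunP => x; rewrite ffunE (bigD1 1%g) //= big1 ?addr0.
  by rewrite ffunE eqxx mul1r invg1 mul1g.
by move=> y /negPf y1; rewrite ffunE y1 mul0r.
Qed.

Fact gr_mul1r : right_id (gr_elt 1) gr_mul.
Proof.
move=> f; apply/ffunP => x; rewrite ffunE (bigD1 x) //= big1 ?addr0.
  by rewrite ffunE mulVg eqxx mulr1.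
by move=> y yx; rewrite ffunE -eq_mulVg1 (negPf yx) mulr0.
Qed.

Fact gr_mulDl : left_distributive gr_mul +%R.
Proof.
move=> f g h; apply/ffunP => x; rewrite !(ffunE, gr_addE) -big_split /=.
by apply: eq_bigr => y _; rewrite gr_addE mulrDl.
Qed.

Fact gr_mulDr : right_distributive gr_mul +%R.
Proof.
move=> f g h; apply/ffunP => x; rewrite !(ffunE, gr_addE) -big_split /=.
by apply: eq_bigr => y _; rewrite gr_addE mulrDr.
Qed.

HB.instance Definition _ := GRing.Zmodule_isPzRing.Build (group_ring R gT)
  gr_mulA gr_mul1l gr_mul1r gr_mulDl gr_mulDr.

Lemma gr_mulE f g x : (f * g) x = \sum_y f y * g (y^-1 * x)%g.
Proof. exact: ffunE. Qed.

End GroupRing.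

Section GroupRingPush.
Variables (R : pzRingType) (gT hT : finGroupType) (r : gT -> hT).

Definition gr_push (f : group_ring R gT) : group_ring R hT :=
  [ffun y => \sum_(x | r x == y) f x].

Fact gr_push_additive : zmod_morphism gr_push.
Proof.
move=> f g; apply/ffunP => y; rewrite !ffunE -sumrB.
by apply: eq_bigr => x _; rewrite !ffunE.
Qed.

HB.instance Definition _ := GRing.isZmodMorphism.Build
  (group_ring R gT) (group_ring R hT) gr_push gr_push_additive.

Lemma gr_push_elt x : gr_push (gr_elt R x) = gr_elt R (r x).
Proof.
apply/ffunP => y; rewrite !ffunE; have [->|neq] := eqVneq y (r x).
  rewrite (bigD1 x) //= ffunE eqxx big1 ?addr0 // => z /andP[_ /negPf zx].
  by rewrite ffunE zx.
rewrite big1 // => z /eqP rz; rewrite ffunE; case: eqP => // zx.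
by rewrite -rz zx eqxx in neq.
Qed.

Hypothesis rM : {morph r : x y / (x * y)%g}.

Lemma gr_pushM f g : gr_push (f * g) = gr_push f * gr_push g.
Proof.
apply/ffunP => y; rewrite gr_mulE !ffunE.
under eq_bigr => x _ do rewrite gr_mulE.
rewrite exchange_big /=.
transitivity (\sum_x f x * gr_push g ((r x)^-1 * y)%g).
  apply: eq_bigr => x _; rewrite ffunE mulr_sumr.
  rewrite (reindex_inj (mulgI x)) /=; apply: eq_big => z; last by rewrite mulKg.
  by rewrite rM -(inj_eq (mulgI (r x)^-1)%g) mulKg.
rewrite (partition_big r xpredT) //=; apply: eq_bigr => z _.
by rewrite ffunE mulr_suml; apply: eq_bigr => x /eqP ->.
Qed.
End GroupRingPush.

Section GroupRingAction.
Variables (R : pzRingType) (gT : finGroupType) (V : lmodType R).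
Variable act : gT -> {linear V -> V}.

Definition gr_act (f : group_ring R gT) (v : V) : V := \sum_x f x *: act x v.

Lemma gr_actDl v : {morph gr_act^~ v : f g / f + g}.
Proof.
by move=> f g; rewrite /gr_act -big_split; apply: eq_bigr => x _; rewrite gr_addE scalerDl.
Qed.

Lemma gr_actDr f : {morph gr_act f : u v / u + v}.
Proof.
move=> u v; rewrite /gr_act -big_split; apply: eq_bigr => x _.
by rewrite linearD scalerDr.
Qed.

Lemma gr_act_elt x v : gr_act (gr_elt R x) v = act x v.
Proof.
rewrite /gr_act (bigD1 x) //= big1 ?addr0; first by rewrite ffunE eqxx scale1r.
by move=> y /negPf yx; rewrite ffunE yx scale0r.
Qed.

Hypothesis actM : forall x y v, act (x * y)%g v = act x (act y v).

Lemma gr_actM f g v : gr_act f (gr_act g v) = gr_act (f * g) v.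
Proof.
rewrite /gr_act; under [RHS]eq_bigr => x _ do rewrite gr_mulE scaler_suml.
rewrite [RHS]exchange_big /=; apply: eq_bigr => y _.
rewrite linear_sum scaler_sumr (reindex_inj (mulgI y^-1)%g); apply: eq_bigr => x _.
by rewrite linearZ /= scalerA -actM mulKVg.
Qed.
End GroupRingAction.

(* Finf is the union of the layers F_n, where F_n / F is cyclic of degree p ^ n.
   A splitting field over F is Galois over F in characteristic 0, and F_0 = F
   because it has degree 1; 'Gal({:layer n} / 1) is Gal(F_n / F). *)
Record Zp_extension (p : nat) (F : fieldExtType rat) := ZpExtension {
  Finf : fieldType;
  layer : nat -> splittingFieldType F;
  layer_incl : forall n, 'AHom(layer n, layer n.+1);
  layer_emb : forall n, {rmorphism layer n -> Finf};
  layer_emb_incl : forall n x, layer_emb n.+1 (layer_incl n x) = layer_emb n x;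
  layer_union : forall y : Finf, exists n, exists x : layer n, layer_emb n x = y;
  layer_cyclic : forall n, cyclic 'Gal({:layer n} / 1)%g;
  layer_degree : forall n, \dim {:layer n} = (p ^ n)%N }.

(* Finf is contained in F(mu_{p^oo}). *)
Definition is_cyclotomic p F (T : Zp_extension p F) : Prop :=
  forall n, exists (k : nat) (E : fieldExtType F) (z : E) (h : 'AHom(layer T n, E)),
    (p ^ k)%N.-primitive_root z /\ (limg h <= <<1; z>>)%VS.

(* Gal(Finf / F) *)
Record Gal_inf p F (T : Zp_extension p F) := GalInf {
  gal_inf_fun :> {rmorphism Finf T -> Finf T};
  gal_inf_bij : bijective gal_inf_fun;
  gal_inf_fix : forall a : F,
    gal_inf_fun (layer_emb T 0%N a%:A) = layer_emb T 0%N a%:A }.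

(* Density of the powers of gamma for the Krull topology; exponents in nat are
   enough because each Gal(F_n / F) is finite. *)
Definition is_top_generator p F (T : Zp_extension p F) (gamma : Gal_inf T) : Prop :=
  forall (s : Gal_inf T) (n : nat), exists k : nat, forall x : layer T n,
    s (layer_emb T n x) = iter k gamma (layer_emb T n x).

Section Tower.
Variables (p : nat) (F : fieldExtType rat) (T : Zp_extension p F).

Definition layer_gal n : finGroupType := gal_of {:layer T n}.

Lemma layer_gal_abelian n (s t : layer_gal n) : (s * t = t * s)%g.
Proof.
have in_gal (u : layer_gal n) : u \in 'Gal({:layer T n} / 1)%g.
  by rewrite gal_kHom ?sub1v // k1AHom.
have /centsP := cyclic_abelian (layer_cyclic T n).
by apply; apply: in_gal.
Qed.

Definition layer_restr n (s : layer_gal n.+1) : layer_gal n :=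
  gal_restr (layer_incl T n) (gal_repr s \o layer_incl T n).

Lemma gal_alg (L : splittingFieldType F) (s : gal_of {:L}) (a : F) : s a%:A = a%:A.
Proof. by rewrite linearZ /= rmorph1. Qed.

Lemma layer_restrE n (s : layer_gal n.+1) x :
  layer_incl T n (layer_restr s x) = s (layer_incl T n x).
Proof.
apply: (gal_restrE (i := layer_incl T n) (j := gal_repr s \o layer_incl T n)).
move=> a /=; have E : layer_incl T n a%:A = a%:A by rewrite linearZ /= rmorph1.
by rewrite [LHS]E -[LHS](gal_alg s) -E.
Qed.

Lemma layer_restr_eq n (s : layer_gal n.+1) (t : layer_gal n) :
  (forall x, layer_incl T n (t x) = s (layer_incl T n x)) -> layer_restr s = t.
Proof.
move=> tE; apply: (gal_restr_unique (i := layer_incl T n)) => x /=.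
by rewrite [LHS]layer_restrE tE.
Qed.

Lemma layer_restrM n : {morph @layer_restr n : s t / (s * t)%g}.
Proof.
move=> s t; apply: layer_restr_eq => x.
by rewrite !galM ?memvf // !layer_restrE.
Qed.

Lemma layer_restr1 n : @layer_restr n 1 = 1%g.
Proof. by apply: layer_restr_eq => x; rewrite !gal_id. Qed.

(* Zp[[Gal(Finf / F)]] = lim_n Zp[Gal(F_n / F)] *)
Definition Lambda : Type :=
  plim (A := fun n => group_ring (padic_int p) (layer_gal n))
       (fun n => gr_push (R := padic_int p) (@layer_restr n)).

HB.instance Definition _ := GRing.Zmodule.on Lambda.

Fact Lambda_one_subproof n :
  gr_push (R := padic_int p) (@layer_restr n) (1 : group_ring _ _) = 1.
Proof. by rewrite gr_push_elt layer_restr1. Qed.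

Definition Lambda_one : Lambda :=
  PLim (A := fun n => group_ring (padic_int p) (layer_gal n))
       (f := fun n => gr_push (R := padic_int p) (@layer_restr n)) Lambda_one_subproof.

Fact Lambda_mul_subproof (a b : Lambda) n :
  gr_push (R := padic_int p) (@layer_restr n) (a n.+1 * b n.+1) = a n * b n.
Proof. by rewrite gr_pushM; [rewrite (plimP a n) (plimP b n) | exact: layer_restrM]. Qed.

Definition Lambda_mul (a b : Lambda) : Lambda :=
  PLim (A := fun n => group_ring (padic_int p) (layer_gal n))
       (f := fun n => gr_push (R := padic_int p) (@layer_restr n)) (Lambda_mul_subproof a b).

Fact Lambda_mulA : associative Lambda_mul.
Proof. by move=> a b c; apply: plim_inj => n /=; rewrite mulrA. Qed.
Fact Lambda_mul1l : left_id Lambda_one Lambda_mul.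
Proof. by move=> a; apply: plim_inj => n /=; rewrite mul1r. Qed.
Fact Lambda_mul1r : right_id Lambda_one Lambda_mul.
Proof. by move=> a; apply: plim_inj => n /=; rewrite mulr1. Qed.
Fact Lambda_mulDl : left_distributive Lambda_mul +%R.
Proof. by move=> a b c; apply: plim_inj => n /=; rewrite mulrDl. Qed.
Fact Lambda_mulDr : right_distributive Lambda_mul +%R.
Proof. by move=> a b c; apply: plim_inj => n /=; rewrite mulrDr. Qed.

HB.instance Definition _ := GRing.Zmodule_isPzRing.Build Lambda
  Lambda_mulA Lambda_mul1l Lambda_mul1r Lambda_mulDl Lambda_mulDr.

Definition gal_inf_restr (s : Gal_inf T) n : layer_gal n :=
  gal_restr (layer_emb T n) (gal_inf_fun s \o layer_emb T n).

Lemma gal_inf_restrE (s : Gal_inf T) n x :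
  layer_emb T n (gal_inf_restr s n x) = s (layer_emb T n x).
Proof.
apply: (gal_restrE (i := layer_emb T n) (j := gal_inf_fun s \o layer_emb T n)).
elim: n {x} => [|n IH] a /=; first by rewrite gal_inf_fix.
have -> : a%:A = layer_incl T n a%:A by rewrite linearZ /= rmorph1.
by rewrite layer_emb_incl; apply: IH.
Qed.

Lemma gal_inf_restr_compat (s : Gal_inf T) n :
  layer_restr (gal_inf_restr s n.+1) = gal_inf_restr s n.
Proof.
apply: layer_restr_eq => x; apply: (fmorph_inj (layer_emb T n.+1)).
by rewrite layer_emb_incl !gal_inf_restrE layer_emb_incl.
Qed.

Fact Lambda_elt_subproof (s : Gal_inf T) n :
  gr_push (R := padic_int p) (@layer_restr n) (gr_elt (padic_int p) (gal_inf_restr s n.+1))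
    = gr_elt (padic_int p) (gal_inf_restr s n).
Proof. by rewrite gr_push_elt gal_inf_restr_compat. Qed.

(* The canonical map Gal(Finf / F) -> Lambda. *)
Definition Lambda_elt (s : Gal_inf T) : Lambda :=
  PLim (A := fun n => group_ring (padic_int p) (layer_gal n))
       (f := fun n => gr_push (R := padic_int p) (@layer_restr n)) (Lambda_elt_subproof s).

Definition U' n : zmodType := p_units p (layer T n).
Definition barU' n := completion p (U' n).
HB.instance Definition _ n := GRing.Lmodule.on (barU' n).

Definition gal_barU' n (s : layer_gal n) : {linear barU' n -> barU' n} :=
  @completion_map p (U' n) (U' n) (p_units_map p (gal_repr s)).

Lemma gal_barU'M n (s t : layer_gal n) u :
  gal_barU' (s * t)%g u = gal_barU' s (gal_barU' t u).
Proof.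
rewrite layer_gal_abelian; apply/esym/completion_map_comp => x.
by apply: val_inj; rewrite /= galM ?memvf.
Qed.

Definition norm_barU' n : {linear barU' n.+1 -> barU' n} :=
  @completion_map p (U' n.+1) (U' n) (p_units_norm (layer_incl T n) p).

Lemma norm_gal_barU' n (s : layer_gal n.+1) u :
  norm_barU' n (gal_barU' s u) = gal_barU' (layer_restr s) (norm_barU' n u).
Proof.
pose h := p_units_norm (layer_incl T n) p \o p_units_map p (gal_repr s).
rewrite [LHS](@completion_map_comp _ _ _ _ _ _ h) //.
apply/esym/completion_map_comp => x; apply: val_inj => /=.
apply: (fmorph_inj (layer_incl T n)) => /=.
rewrite [LHS]layer_restrE [in LHS]rel_normE [RHS]rel_normE /galNorm rmorph_prod.
apply: eq_bigr => g _ /=.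
by rewrite -!galM ?memvf // layer_gal_abelian.
Qed.

Definition barU'_inf : Type := plim (A := barU') norm_barU'.
HB.instance Definition _ := GRing.Zmodule.on barU'_inf.

Fact barU'_inf_scale_subproof (a : Lambda) (u : barU'_inf) n :
  norm_barU' n (gr_act (@gal_barU' n.+1) (a n.+1) (u n.+1))
    = gr_act (@gal_barU' n) (a n) (u n).
Proof.
rewrite /gr_act linear_sum (partition_big (@layer_restr n) xpredT) //=.
apply: eq_bigr => t _; rewrite -(plimP a n) ffunE scaler_suml.
by apply: eq_bigr => s /eqP <-; rewrite linearZ /= norm_gal_barU' (plimP u n).
Qed.

Definition barU'_inf_scale (a : Lambda) (u : barU'_inf) : barU'_inf :=
  PLim (A := barU') (f := norm_barU') (barU'_inf_scale_subproof a u).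

Fact barU'_inf_scaleA a b u : barU'_inf_scale a (barU'_inf_scale b u) = barU'_inf_scale (a * b) u.
Proof. by apply: plim_inj => n; apply/gr_actM/gal_barU'M. Qed.
Fact barU'_inf_scale1 : left_id 1 barU'_inf_scale.
Proof.
move=> u; apply: plim_inj => n /=; rewrite [LHS]gr_act_elt.
by apply: completion_map_id => x; apply: val_inj; rewrite /= gal_id.
Qed.
Fact barU'_inf_scaleDr : right_distributive barU'_inf_scale +%R.
Proof. by move=> a u v; apply: plim_inj => n; apply: gr_actDr. Qed.
Fact barU'_inf_scaleDl u : {morph barU'_inf_scale^~ u : a b / a + b}.
Proof. by move=> a b; apply: plim_inj => n; apply: gr_actDl. Qed.

HB.instance Definition _ := GRing.Zmodule_isLmodule.Build Lambda barU'_inf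
  barU'_inf_scaleA barU'_inf_scale1 barU'_inf_scaleDr barU'_inf_scaleDl.

Lemma barU'_inf_scale_elt (s : Gal_inf T) (u : barU'_inf) n :
  (Lambda_elt s *: u) n = gal_barU' (gal_inf_restr s n) (u n).
Proof. exact: gr_act_elt. Qed.

(* The kernel of the projection onto the component of index 0. *)
Definition barU'_inf0_pred : {pred barU'_inf} := fun u => u 0%N == 0.

Fact barU'_inf0_submod_closed : submod_closed barU'_inf0_pred.
Proof.
split=> [|a u v /eqP u0 /eqP v0]; first exact: eqxx.
apply/eqP; rewrite [LHS](_ : _ = (a *: u) 0 + v 0) // v0 addr0.
rewrite [LHS](_ : _ = gr_act (@gal_barU' 0) (a 0) (u 0)) // u0 /gr_act big1 // => s _.
by rewrite linear0 scaler0.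
Qed.

HB.instance Definition _ := GRing.isSubmodClosed.Build Lambda barU'_inf barU'_inf0_pred
  barU'_inf0_submod_closed.

Record barU'_inf0 := MkBarU'_inf0 { barU'_inf0_val :> barU'_inf; _ : barU'_inf0_val \in barU'_inf0_pred }.
HB.instance Definition _ := [isSub for barU'_inf0_val].
HB.instance Definition _ := [Choice of barU'_inf0 by <:].
HB.instance Definition _ := [SubChoice_isSubLmodule of barU'_inf0 by <:].

End Tower.

(* Main.v *)
Require Import Defs.
From HB Require Import structures.
From mathcomp Require Import all_boot all_order all_algebra all_fingroup all_solvable all_field.
From mathcomp Require Import boolp classical_sets.
From mathcomp Require Import ring lra zify.

(** Write F_n for the layers and N_(m/n) for the norm from F_m to F_n. Elements of the union
of the layers are used to represent the classes in U'_n modulo p ^ m, so that the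
norms become products over powers of gamma ([tnorm]), and the theorem reduces to two
statements about p-units modulo p-powers.

- Injectivity rests on [tnorm_invariant]: if y in F_j is fixed by gamma modulo p ^ j-th powers,
  then N_(j/n)(y) is a p ^ m-th power, for j large in terms of n and m. Indeed
  gamma y / y = x ^ (p ^ j), the norm of x to F_0 is a root of unity, so a bounded
  power of x has norm 1 and is gamma w / w by Hilbert's Theorem 90. Hence a bounded power of y is
  f * w ^ (p ^ j) with f in F_0, and norms raise f to a large p-power. The roots of unity
  lost in extracting the bounded root die under further norms, because there are
  finitely many of given order in the union.

- Surjectivity rests on [norm_coboundary]: if u in F_j is a p-unit whose norm to F_0 is
  a p ^ M-th power, with j and M large, then N_(j/n)(u) is (gamma w / w) * z ^ (p ^ m) with w
  a p-unit of F_n. Hilbert's Theorem 90 gives gamma v / v = u up to a p-power with v in F_j,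
  not yet a p-unit. The ideal of v outside p is invariant modulo p-powers, so
  the ideal of W = N_(j/n)(v) is a p-power in F_j. Since F_j / F_n is unramified
  outside p ([unramified_root]) it is the p-power of an ideal of F_n, and since the class group
  of F_n is finite ([class_group_exponent]) W is a p-unit up to a slightly smaller p-power.

Solutions of (gamma - 1) w = u found at each finite level need not be compatible. By
[tnorm_invariant], however, two solutions at the same high level have the same norm to F_n
modulo p ^ m, so these norms form an element of the limit ([delta_surj]).

The finiteness of the class group is proved in terms of valuation rings. The norm of
an element of all valuation rings is an integer ([int_rnorm_integral]); a fractional
ideal thus has an element of least norm, and Dirichlet's approximation argument
([lattice_approximation]) confines the ideal between two lattices. *)

Set Implicit Arguments.
Unset Strict Implicit.
Unset Printing Implicit Defensive.

Import Order.TTheory GRing.Theory Num.Theory.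
Local Open Scope ring_scope.

(** * Valuation rings *)

(** As 0^-1 = 0 lies in V, zero has to be excluded. *)
Definition vunit (K : fieldType) (V : set K) (x : K) : Prop :=
  [/\ x != 0, V x & V x^-1].

Section ValuationRing.
Variables (K : fieldType) (V : set K).
Hypothesis valV : is_valuation_ring V.
Let ringV : is_subring V. Proof. by case: valV. Qed.

Lemma valringX x n : V x -> V (x ^+ n).
Proof.
move=> Vx; elim: n => [|n IH]; first exact: subring1.
by rewrite exprS; apply: subringM.
Qed.

Lemma valring_nat n : V n%:R.
Proof.
elim: n => [|n IH]; first exact: subring0.
by rewrite mulrS; apply: subringD => //; apply: subring1.
Qed.

Lemma valring_int (n : int) : V n%:~R.
Proof.
case: n => n; first exact: valring_nat.
by rewrite NegzE mulrNz; apply: subringN => //; apply: valring_nat.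
Qed.

Lemma valring_root x n : (0 < n)%N -> V (x ^+ n) -> V x.
Proof.
move=> n0 Vxn; have [_ /(_ x)[//|Vxi]] := valV.
have [->|x0] := eqVneq x 0; first exact: subring0.
rewrite -(mulfK (expf_neq0 n.-1 x0) x) -exprS prednK // -exprVn.
by apply: subringM => //; apply: valringX.
Qed.

Lemma vunit1 : vunit V 1.
Proof. by split; rewrite ?invr1 ?oner_neq0 //; apply: subring1. Qed.

Lemma vunitM x y : vunit V x -> vunit V y -> vunit V (x * y).
Proof.
move=> [x0 Vx Vxi] [y0 Vy Vyi].
by split; [exact: mulf_neq0 | exact: subringM | rewrite invfM; exact: subringM].
Qed.

Lemma vunitV x : vunit V x -> vunit V x^-1.
Proof. by move=> [x0 Vx Vxi]; split; rewrite ?invr_eq0 ?invrK. Qed.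

Lemma vunitX x n : vunit V x -> vunit V (x ^+ n).
Proof.
by move=> Ux; elim: n => [|n IH]; rewrite ?expr0 ?exprS; [exact: vunit1 | exact: vunitM].
Qed.

Lemma vunit_root x n : (0 < n)%N -> vunit V (x ^+ n) -> vunit V x.
Proof.
move=> n0 [xn0 Vxn Vxni]; split; first by move: xn0; rewrite expf_eq0 n0.
  exact: (valring_root n0 Vxn).
by apply: (valring_root n0); rewrite exprVn.
Qed.

(** The non-units of a valuation ring form an ideal. *)
Lemma vunit_sum (I : eqType) (r : seq I) (F : I -> K) :
  (forall i, i \in r -> V (F i)) -> vunit V (\sum_(i <- r) F i) ->
  exists2 i, i \in r & vunit V (F i).
Proof.
elim: r => [|i r IH] VF; first by rewrite big_nil => -[]; rewrite eqxx.
have VFr j : j \in r -> V (F j) by move=> jr; apply: VF; rewrite inE jr orbT.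
rewrite big_cons; set S := \sum_(j <- r) _ => -[S0 VS VSi].
have VSr : V S by rewrite /S big_seq; apply: subring_sum.
have [Fi0|Fi0] := eqVneq (F i) 0.
  rewrite Fi0 add0r in S0 VS VSi.
  by have [||j jr Fj] := IH; [| |exists j => //; rewrite inE jr orbT].
have [VFi|nVFi] := pselect (V (F i)^-1).
  by exists i; [exact: mem_head | split=> //; apply: VF; exact: mem_head].
have [S00|Sn0] := eqVneq S 0.
  by rewrite S00 addr0 in VSi; case: nVFi.
have [VSi'|nVSi'] := pselect (V S^-1).
  by have [||j jr Fj] := IH; [| |exists j => //; rewrite inE jr orbT].
case: nVFi; have [_ /(_ (F i / S))[h|h]] := valV.
  case: nVSi'; have -> : S^-1 = (F i + S)^-1 * (F i / S + 1).
    by rewrite -(divff Sn0) -mulrDl mulrA mulVf ?mul1r.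
  by apply: subringM => //; apply: subringD => //; apply: subring1.
have -> : (F i)^-1 = (F i + S)^-1 * (1 + (F i / S)^-1).
  by rewrite invf_div -(divff Fi0) -mulrDl mulrA mulVf ?mul1r.
by apply: subringM => //; apply: subringD => //; apply: subring1.
Qed.

End ValuationRing.

Lemma valring_max (K : fieldType) (V : set K) (I : eqType) (r : seq I) (b : I -> K) :
  is_valuation_ring V -> (0 < size r)%N -> (forall i, b i != 0) ->
  exists2 i, i \in r & forall j, j \in r -> V (b j / b i).
Proof.
move=> valV; have [ringV totV] := valV => + b0.
elim: r => // i [|k r] IH _.
  exists i; first exact: mem_head.
  by move=> j; rewrite inE => /eqP ->; rewrite divff //; apply: subring1.
have [//|l lr Hl] := IH.
have [h|h] := totV (b i / b l).
  exists l; first by rewrite inE lr orbT.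
  by move=> j; rewrite inE => /orP[/eqP -> //|]; apply: Hl.
exists i; first exact: mem_head.
move=> j; rewrite inE => /orP[/eqP ->|jr]; first by rewrite divff //; apply: subring1.
have -> : b j / b i = (b j / b l) * (b i / b l)^-1.
  by rewrite invf_div mulrA divfK.
by apply: (subringM ringV) => //; apply: Hl.
Qed.

Lemma valring_comap (K M : fieldType) (i : {rmorphism K -> M}) (V : set M) :
  is_valuation_ring V -> is_valuation_ring [set x | V (i x)]%classic.
Proof.
move=> [ringV totV]; split; last by move=> x; rewrite /= fmorphV.
split=> /= [|x y Vx Vy|x y Vx Vy]; first by rewrite rmorph1; apply: subring1.
  by rewrite rmorphB; apply: subringB.
by rewrite rmorphM; apply: subringM.
Qed.

Lemma p_unit_vunit p (K : fieldType) (x : K) :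
  is_p_unit p x <-> x != 0 /\ forall V, is_valuation_ring V -> V p%:R^-1 -> vunit V x.
Proof.
split=> -[x0 Ux]; split=> // V valV Vp; first by have [] := Ux V valV Vp.
by have [] := Ux V valV Vp.
Qed.

(** * Denominators of algebraic numbers *)

Lemma intr_alg_eq0 (L : fieldExtType rat) (n : int) : (n%:~R == 0 :> L) = (n == 0).
Proof. by rewrite -(rmorph_int (in_alg L)) fmorph_eq0 intr_eq0. Qed.

Lemma integer_equation (L : fieldExtType rat) (g : L) :
  exists P : {poly int}, P != 0 /\ root (map_poly intr P) g.
Proof.
have [/polyOver1P[q qE] rq] := (minPolyOver 1 g, root_minPoly 1 g).
have [P [a a0 qP]] := rat_poly_scale q.
exists P; split.
  apply: contraNneq (monic_neq0 (monic_minPoly 1 g)) => P0.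
  by rewrite qE qP P0 map_poly0 scaler0 map_poly0.
move: rq; rewrite qE qP map_polyZ /= -map_poly_comp rootE hornerZ mulf_eq0.
rewrite [_%:A == 0]scaler_eq0 oner_eq0 orbF invr_eq0 intr_eq0 (negPf a0) /=.
by rewrite -rootE (eq_map_poly (g := intr)) // => x; exact: (rmorph_int (in_alg L)).
Qed.

Section Localization.
Variables (L : fieldExtType rat) (V : set L).
Hypothesis valV : is_valuation_ring V.
Let ringV : is_subring V. Proof. by case: valV. Qed.

(** The content is an integral combination of the coefficients, so these are not all in
the ideal of non-units of V. *)
Lemma vunit_coef_of_content (P : {poly int}) :
  zcontents P = 1 -> exists i, vunit V (P`_i)%:~R.
Proof.
move=> P1; apply: contrapT => /forallNP nU.
suff : ~ vunit V (\big[gcdn/0%N]_(i < size P) `|(P`_i)%R|%N)%:R.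
  move: P1; rewrite /zcontents; case: sgzP => // _; rewrite ?mul0r ?mul1r ?mulN1r.
    by move=> [->] []; exact: vunit1.
  by move=> h; exfalso; move: h; case: (\big[_/_]_(_ < _) _).
elim/big_ind: _ => [|m n Um Un Umn|i _ [c0 Vc Vci]].
- by case; rewrite eqxx.
- have [u [v uvE]] := Bezoutz m%:Z n%:Z.
  move: Umn; rewrite -[_%:R]/((gcdz m n)%:~R) -uvE rmorphD !rmorphM /= -!pmulrn => Umn.
  (* the two terms of the Bezout relation are indexed by bool *)
  have [||i] := @vunit_sum _ _ valV bool [:: true; false]
     (fun b => if b then u%:~R * m%:R else v%:~R * n%:R).
  + by case=> _; apply: (subringM ringV); rewrite ?pmulrn; apply: valring_int.
  + by rewrite !big_cons big_nil addr0.
  case: i => _ [+ _].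
    rewrite mulf_eq0 negb_or => /andP[u0 m0] Vi; apply: Um; split=> //.
      exact: valring_nat.
    rewrite -(mulfK u0 m%:R) invfM invrK mulrC mulrC (mulrC m%:R).
    by apply: (subringM ringV) => //; apply: valring_int.
  rewrite mulf_eq0 negb_or => /andP[u0 m0] Vi; apply: Un; split=> //.
    exact: valring_nat.
  rewrite -(mulfK u0 n%:R) invfM invrK mulrC mulrC (mulrC n%:R).
  by apply: (subringM ringV) => //; apply: valring_int.
apply: (nU i); have absE : (`|(P`_i)%R|%N)%:R = (P`_i)%:~R :> L \/ (`|(P`_i)%R|%N)%:R = - (P`_i)%:~R :> L.
  by case: (P`_i) => k; [left|right]; rewrite ?NegzE ?abszN ?mulrNz ?opprK -?pmulrn.
case: absE c0 Vc Vci => ->; first by move=> *; split.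
rewrite oppr_eq0 invrN => c0 Vc Vci; split=> //; first by rewrite -[X in V X]opprK; apply: subringN.
by rewrite -[X in V X]opprK; apply: subringN.
Qed.

(** V is a localization of the ring of integers, the intersection of all valuation
rings V'. If a_0 + ... + a_n g^n = 0 with coprime integers a_i, the elements
b_i = a_i + a_(i+1) g + ... + a_n g^(n-i) and b_i g = b_(i-1) - a_(i-1) lie in every V': the
defining formula shows it when g is in V', and the formula
b_i = - (a_(i-1) g^-1 + ... + a_0 g^-i) when g^-1 is. Not all b_i are non-units of V,
since a_i = b_i - b_(i+1) g and some a_i is a unit of V. *)
Lemma integral_denominator (g : L) : V g ->
  exists b, vunit V b /\ forall V', is_valuation_ring V' -> V' b /\ V' (b * g).
Proof.
move=> Vg; have [P0 [P00 rP0]] := integer_equation g.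
have [P P1 rP] : exists2 P, zcontents P = 1 & root (map_poly intr P) g.
  exists (zprimitive P0); first by rewrite zcontents_primitive P00.
  move: rP0; rewrite {1}(zpolyEprim P0) map_polyZ /= rootE hornerZ mulf_eq0.
  by rewrite intr_alg_eq0 zcontents_eq0 (negPf P00).
pose a i : L := (P`_i)%:~R.
have Va V' i : is_valuation_ring V' -> V' (a i) by move=> valV'; apply: valring_int.
have sumP : \sum_(i < size P) a i * g ^+ i = 0.
  have := rP; rewrite rootE (horner_coef_wide (n := size P)); last exact: size_poly.
  by move/eqP=> h; rewrite -[RHS]h; apply: eq_bigr => i _; rewrite coef_map_id0.
pose n := size P; pose b i := \sum_(i <= j < n) a j * g ^+ (j - i).
have bS i : b i = a i + b i.+1 * g.
  rewrite /b mulr_suml; have [lein|ltni] := ltnP i n.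
    rewrite big_ltn // subnn expr0 mulr1; congr (_ + _).
    rewrite big_nat [RHS]big_nat; apply: eq_bigr => j /andP[ij _].
    by rewrite -mulrA -exprSr subnSK.
  rewrite !big_geq //; last by rewrite ltnW // ltnS.
  by rewrite /a nth_default // addr0.
have b0 : b 0%N = 0.
  by rewrite -[RHS]sumP /b big_mkord; apply: eq_bigr => j _; rewrite subn0.
have allb V' : is_valuation_ring V' -> forall i, V' (b i) /\ V' (b i.+1 * g).
  move=> valV' i; have [ringV' totV'] := valV'.
  suff Vb j : V' (b j).
    split=> //; have -> : b i.+1 * g = b i - a i by rewrite [b i]bS addrAC subrr add0r.
    by apply: subringB => //; apply: Va.
  have [V'g|V'gi] := totV' g.
    apply: (subring_sum ringV') => l _; apply: (subringM ringV'); first exact: Va.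
    exact: valringX.
  have [g0|g0] := eqVneq g 0.
    apply: (subring_sum ringV') => l _; apply: (subringM ringV'); first exact: Va.
    by apply: valringX => //; rewrite g0; apply: subring0.
  elim: j => [|j IH]; first by rewrite b0; apply: subring0.
  have -> : b j.+1 = (b j - a j) * g^-1 by rewrite [b j]bS addrAC subrr add0r mulfK.
  by apply: (subringM ringV') => //; apply: (subringB ringV') => //; apply: Va.
have [i Ui] := vunit_coef_of_content P1.
have aE : a i = b i - b i.+1 * g by rewrite [b i]bS addrK.
have [||k _] := @vunit_sum _ _ valV bool [:: true; false]
   (fun k => if k then b i else - (b i.+1 * g)).
- by case=> _; [|apply: subringN => //]; have [] := allb V valV i.
- by rewrite !big_cons big_nil addr0 -aE.
case: k => Uk.
  exists (b i); split=> // V' valV'; split; first by have [] := allb V' valV' i.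
  case: i {Ui aE} Uk => [|i] Uk; last by have [] := allb V' valV' i.
  by rewrite b0 mul0r; apply: subring0; case: valV'.
exists (b i.+1); split.
  have [+ _ Vi] := Uk; rewrite oppr_eq0 mulf_eq0 negb_or => /andP[bn0 gn0]; split=> //.
    by have [] := allb V valV i.+1.
  have -> : (b i.+1)^-1 = - g * (- (b i.+1 * g))^-1.
    by rewrite invrN mulrNN invfM mulrCA mulfV ?mulr1.
  by apply: (subringM ringV) => //; apply: subringN.
by move=> V' valV'; split; [have [] := allb V' valV' i.+1 | have [] := allb V' valV' i].
Qed.

End Localization.

(** * The norm of a number field *)

Section RationalNorm.
Variable L : fieldExtType rat.
Local Notation d := (\dim {:L}).
Local Notation b := (vbasis {:L}).
Implicit Types x y : L.

Lemma dim_full_gt0 : (0 < d)%N.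
Proof. by rewrite lt0n dimv_eq0 -subv0; apply/negP => /subvP/(_ 1 (memvf _)); rewrite memv0 oner_eq0. Qed.

Lemma vbasis_neq0 (i : 'I_d) : b`_i != 0.
Proof. by apply: (basis_not0 (vbasisP {:L})); apply: mem_nth; rewrite size_tuple. Qed.

Lemma vbasis_coordE x : x = \sum_(j < d) coord b j x *: b`_j.
Proof. exact: coord_vbasis (memvf x). Qed.

Definition mulmat x : 'M[rat]_d := \matrix_(i, j) coord b j (x * b`_i).

Lemma mulmat_basis x (i : 'I_d) : x * b`_i = \sum_j mulmat x i j *: b`_j.
Proof. by rewrite [LHS]vbasis_coordE; apply: eq_bigr => j _; rewrite mxE. Qed.

Fact mulmat_linear : linear mulmat.
Proof. by move=> a x y; apply/matrixP => i j; rewrite !mxE mulrDl -scalerAl linearP. Qed.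
HB.instance Definition _ := GRing.isLinear.Build rat L 'M[rat]_d *:%R mulmat mulmat_linear.

Lemma mulmat1 : mulmat 1 = 1%:M.
Proof.
apply/matrixP => i j; rewrite !mxE mul1r coord_free ?(basis_free (vbasisP _)) //.
Qed.

Lemma mulmatM x y : mulmat (x * y) = mulmat y *m mulmat x.
Proof.
apply/matrixP => i k; rewrite !mxE -mulrA (mulmat_basis y) mulr_sumr linear_sum.
by apply: eq_bigr => j _; rewrite -scalerAr linearZ !mxE.
Qed.

(** The norm of L over the rationals. *)
Definition rnorm x : rat := \det (mulmat x).

Lemma rnorm1 : rnorm 1 = 1. Proof. by rewrite /rnorm mulmat1 det1. Qed.

Lemma rnormM x y : rnorm (x * y) = rnorm x * rnorm y.
Proof. by rewrite /rnorm mulmatM det_mulmx mulrC. Qed.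

Lemma rnormX x k : rnorm (x ^+ k) = rnorm x ^+ k.
Proof. by elim: k => [|k IH]; rewrite ?expr0 ?rnorm1 // !exprS rnormM IH. Qed.

Lemma rnorm0 : rnorm 0 = 0.
Proof.
rewrite /rnorm linear0; move: dim_full_gt0; case: (\dim {:L}) => // n _.
by rewrite det0.
Qed.

Lemma rnorm_eq0 x : (rnorm x == 0) = (x == 0).
Proof.
have [->|x0] := eqVneq x 0; first by rewrite rnorm0 eqxx.
apply/negbTE/eqP => Nx0; have := rnorm1.
by rewrite -(divff x0) rnormM Nx0 mul0r => /esym/eqP; rewrite oner_eq0.
Qed.

Lemma rnorm_nat m : rnorm m%:R = m%:R ^+ d.
Proof.
have -> : m%:R = m%:R *: 1 :> L by rewrite scaler_nat.
by rewrite /rnorm linearZ /= mulmat1 scalemx1 det_scalar.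
Qed.

Definition int_mulmat x := forall i j, mulmat x i j \is a Num.int.

Lemma int_mulmatD x y : int_mulmat x -> int_mulmat y -> int_mulmat (x + y).
Proof. by move=> xZ yZ i j; rewrite linearD mxE rpredD. Qed.

Lemma int_mulmatZ (k : int) x : int_mulmat x -> int_mulmat (k%:~R *: x).
Proof. by move=> xZ i j; rewrite linearZ mxE rpredM // rpred_int. Qed.

Lemma int_mulmat_sum (I : Type) (r : seq I) (P : pred I) (F : I -> L) :
  (forall i, P i -> int_mulmat (F i)) -> int_mulmat (\sum_(i <- r | P i) F i).
Proof.
move=> FZ; elim/big_rec: _ => [|i x Pi xZ]; last exact/int_mulmatD/xZ/FZ.
by move=> i j; rewrite linear0 mxE rpred0.
Qed.

Lemma int_rnorm x : int_mulmat x -> rnorm x \is a Num.int.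
Proof.
move=> xZ; apply: rpred_sum => s _; rewrite rpredM ?rpredX ?rpredN1 //.
by apply: rpred_prod => i _; apply: xZ.
Qed.

(** Let b_i be a basis element of least valuation. As x * b_i is an integral combination of
the b_j, x is an integral combination of the quotients b_j / b_i, and these lie in V. *)
Lemma int_mulmat_valring x V : int_mulmat x -> is_valuation_ring V -> V x.
Proof.
move=> xZ valV; have [ringV _] := valV.
have [||i _ Vi] := @valring_max _ V _ (enum 'I_d) (fun i => b`_i) valV.
- by rewrite size_enum_ord dim_full_gt0.
- exact: vbasis_neq0.
rewrite -(mulfK (vbasis_neq0 i) x) mulmat_basis mulr_suml.
apply: (subring_sum ringV) => j _; have /intrP[k ->] := xZ i j.
rewrite scaler_int mulrzAl -mulrzl; apply: (subringM ringV).
  exact: valring_int.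
by apply: Vi; rewrite mem_enum.
Qed.

Lemma common_denominator (s : seq L) :
  exists2 D : nat, (0 < D)%N & forall x, x \in s -> int_mulmat (D%:R *: x).
Proof.
elim: s => [|x s [D D0 sD]]; first by exists 1%N.
pose E := (\prod_i \prod_j `|denq (mulmat x i j)|)%N.
have E0 : (0 < E)%N.
  by apply: prodn_gt0 => i; apply: prodn_gt0 => j; rewrite absz_gt0 denq_neq0.
have xE : int_mulmat (E%:R *: x).
  move=> i j; rewrite linearZ mxE; set a := mulmat x i j.
  have /dvdnP[k ->] : (`|denq a| %| E)%N.
    apply: (@dvdn_trans (\prod_l `|denq (mulmat x i l)|)%N).
      by rewrite (bigD1 j) //= dvdn_mulr.
    by rewrite /E [X in (_ %| X)%N](bigD1 i) //= dvdn_mulr.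
  rewrite natrM -mulrA rpredM ?rpred_nat // mulrC.
  by rewrite natr_absz gtr0_norm ?denq_gt0 // -numqE rpred_int.
exists (D * E)%N => [|y]; first by rewrite muln_gt0 D0.
rewrite inE natrM => /orP[/eqP -> | ys].
  by rewrite -scalerA; apply: (@int_mulmatZ D%:Z).
by rewrite mulrC -scalerA; apply: (@int_mulmatZ E%:Z); apply: sD.
Qed.

End RationalNorm.

(** If b is the denominator of r then b ^ E divides E, while E < 2 ^ E. *)
Lemma int_of_bounded_denominators (r : rat) (E : nat) :
  (0 < E)%N -> (forall k, E%:R * r ^+ k \is a Num.int) -> r \is a Num.int.
Proof.
move=> E0 rE; have [m mE] := intrP (rE E); rewrite Qint_def.
have numE : E%:Z * numq r ^+ E = m * denq r ^+ E.
  apply/eqP; rewrite -(eqr_int rat) !rmorphM !rmorphXn /= -mE numqE exprMn.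
  by rewrite mulrA.
have : (`|denq r| ^ E %| E)%N.
  rewrite -(@Gauss_dvdl _ _ (`|numq r| ^ E)); last first.
    by rewrite coprimeXl // coprimeXr // coprime_sym coprime_num_den.
  by rewrite -!abszX -(absz_nat E) -abszM absz_nat numE abszM dvdn_mull.
move/(dvdn_leq E0) => leE; have d1 : (`|denq r| <= 1)%N.
  rewrite leqNgt; apply/negP => d1; have := leq_trans (ltn_expl E d1) leE.
  by rewrite ltnn.
by rewrite -[denq r]gtz0_abs ?denq_gt0 // eqz_nat eqn_leq d1 absz_gt0 denq_neq0.
Qed.

Lemma pigeonhole (T : finType) (f : nat -> T) :
  exists i j, [/\ (i < j)%N, (j <= #|T|)%N & f i = f j].
Proof.
have : ~~ injectiveb (fun i : 'I_(#|T|).+1 => f i).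
  by apply/negP => /injectiveP/leq_card; rewrite card_ord ltnn.
case/injectivePn => i [j ij fij].
have [ltij|ltji|/val_inj eqij] := ltngtP i j; last by rewrite eqij eqxx in ij.
  by exists i, j; split=> //; rewrite -ltnS.
by exists j, i; split=> //; rewrite -ltnS.
Qed.

Section IntegralNorm.
Variable L : fieldExtType rat.

(** An element x of all valuation rings lies in the ring generated by its inverse,
since otherwise a valuation ring containing 1/x could omit x. So x ^ (n + 1) is an
integral combination of 1, ..., x ^ n, and all powers of x have a common denominator. Then
so do the powers of the norm of x, which forces it to be an integer. *)
Lemma int_rnorm_integral (x : L) :
  (forall V, is_valuation_ring V -> V x) -> rnorm x \is a Num.int.
Proof.
move=> xO; have [->|x0] := eqVneq x 0; first by rewrite rnorm0 rpred0.
pose Z : set L := [set z | exists k : int, z = k%:~R]%classic.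
have ringZ : is_subring Z.
  split; first by exists 1.
    by move=> _ _ [k ->] [l ->]; exists (k - l); rewrite rmorphB.
  by move=> _ _ [k ->] [l ->]; exists (k * l); rewrite rmorphM.
have [q Zq qx] : [set q.[x^-1] | q in polyin Z]%classic x.
  apply: contrapT => nRx.
  have [|V [valV _ nVx]] := valuation_extension (adjoin_subring ringZ x^-1) _ nRx.
    exact: adjoin_gen.
  by apply: nVx; apply: xO.
pose s := size q.
have xS l : x ^+ (s.+1 + l) = \sum_(i < s) q`_i * x ^+ (s - i + l).
  rewrite addSn exprS -{1}qx horner_coef mulr_suml; apply: eq_bigr => i _.
  rewrite -mulrA; congr (_ * _); have /subnK isE := ltnW (ltn_ord i).
  have -> : (s + l = i + (s - i + l))%N by rewrite addnA (addnC i) isE.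
  by rewrite exprVn exprD mulKf ?expf_neq0.
have [D D0 Dx] := common_denominator [seq x ^+ i | i <- iota 0 s.+1].
apply: (@int_of_bounded_denominators _ (D ^ \dim {:L})%N); first by rewrite expn_gt0 D0.
move=> k; rewrite natrX -(rnorm_nat L) -rnormX -rnormM; apply: int_rnorm.
have -> : D%:R * x ^+ k = (D%:R : rat) *: x ^+ k by rewrite scaler_nat mulr_natl.
have [K] := ubnP k; elim: K k => // K IH k; rewrite ltnS => leK.
have [lek|ltk] := leqP k s.
  by apply: Dx; apply/mapP; exists k => //; rewrite mem_iota.
rewrite -(subnKC ltk) xS scaler_sumr; apply: int_mulmat_sum => i _.
have [c ->] := Zq i; rewrite mulrzl -scalerMzr -scaler_int; apply: int_mulmatZ.
apply: IH; apply: leq_trans leK; have := ltn_ord i; lia.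
Qed.

End IntegralNorm.

(** * Finiteness of the class group *)

Lemma ler_det (n : nat) (A : 'M[rat]_n) (c : rat) :
  (forall i j, `|A i j| <= c) -> `|\det A| <= n`!%:R * c ^+ n.
Proof.
move=> Ac; apply: le_trans (ler_norm_sum _ _ _) _.
have -> : n`!%:R * c ^+ n = \sum_(s : 'S_n) c ^+ n.
  by rewrite sumr_const card_Sn mulr_natl.
apply: ler_sum => s _; rewrite normrM normrX normrN1 expr1n mul1r normr_prod.
rewrite -[n in c ^+ n]card_ord -prodr_const; apply: ler_prod => i _.
by rewrite normr_ge0 Ac.
Qed.

Section Lattice.
Variable L : fieldExtType rat.
Local Notation d := (\dim {:L}).
Variable e : 'I_d -> L.
Hypotheses (int_e : forall j, int_mulmat (e j))
  (gen_e : forall x, exists q : 'I_d -> rat, x = \sum_j q j *: e j).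

Lemma int_lattice (c : 'I_d -> int) : int_mulmat (\sum_j (c j)%:~R *: e j).
Proof. by apply: int_mulmat_sum => j _; apply: int_mulmatZ. Qed.

Lemma small_rnorm :
  exists2 m : nat, (0 < m)%N & forall q : 'I_d -> rat,
    (forall j, `|q j| * m%:R <= 1) -> `|rnorm (\sum_j q j *: e j)| < 1.
Proof.
pose C := \sum_j \sum_i \sum_k `|mulmat (e j) i k|.
have C0 : 0 <= C.
  by do 3![apply: sumr_ge0 => ? _]; apply: normr_ge0.
(* the entries of the matrix are at most C / m <= 1, and d! * (C / m) < 1 *)
pose m := Num.bound (d`!%:R * C + C + 1).
have mC : d`!%:R * C + C + 1 < m%:R.
  by apply: archi_boundP; rewrite !addr_ge0 ?mulr_ge0.
have m0 : 0 < m%:R :> rat.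
  by apply: le_lt_trans mC; rewrite !addr_ge0 ?mulr_ge0.
exists m => [|q qm]; first by rewrite -(ltr0n rat).
have Aq i k : `|mulmat (\sum_j q j *: e j) i k| <= C / m%:R.
  rewrite linear_sum summxE; apply: le_trans (ler_norm_sum _ _ _) _.
  rewrite /C mulr_suml; apply: ler_sum => j _.
  rewrite linearZ mxE normrM mulrC; apply: ler_pM => //.
    rewrite (bigD1 i) //= (bigD1 k) //= -addrA lerDl addr_ge0 //.
      by apply: sumr_ge0 => ? _; apply: normr_ge0.
    by do 2![apply: sumr_ge0 => ? _]; apply: normr_ge0.
  by rewrite -[_^-1]mul1r ler_pdivlMr.
apply: le_lt_trans (ler_det Aq) _.
have Cm0 : 0 <= C / m%:R by rewrite divr_ge0 // ltW.
have Cm1 : C / m%:R <= 1.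
  rewrite ler_pdivrMr // mul1r; apply: le_trans (ltW mC).
  by rewrite -addrA addrCA lerDl addr_ge0 ?mulr_ge0.
apply: (@le_lt_trans _ _ (d`!%:R * (C / m%:R))).
  rewrite ler_wpM2l // -(prednK (dim_full_gt0 L)) exprS ler_piMr //.
  exact: exprn_ile1.
by rewrite mulrA ltr_pdivrMr // mul1r; apply: le_lt_trans mC; rewrite -addrA lerDl addr_ge0.
Qed.

(** Dirichlet's argument: modulo 1, the coordinates of the multiples of a fall into finitely
many small cubes, so the difference of two multiples is close to the lattice. *)
Lemma lattice_approximation :
  exists2 B : nat, (0 < B)%N & forall a : L, exists t : nat, [/\ (0 < t)%N, (t <= B)%N &
    exists c : 'I_d -> int, `|rnorm (t%:R * a - \sum_j (c j)%:~R *: e j)| < 1].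
Proof.
have [m m0 small] := small_rnorm.
exists #|{ffun 'I_d -> 'I_m}|.
  by rewrite card_ffun !card_ord expn_gt0 m0.
move=> a; have [q aE] := gen_e a.
have frac (x : rat) : 0 <= x - (Num.floor x)%:~R < 1.
  by rewrite subr_ge0 floor_le ltrBlDl -[X in _ + X]/(1%:~R) -intrD floorD1_gt.
have cell0 (x : rat) : 0 <= Num.floor (m%:R * (x - (Num.floor x)%:~R)) < m%:Z.
  have /andP[f0 f1] := frac x.
  by rewrite floor_ge0 floor_lt_int mulr_ge0 //= -[X in _ < X]mulr1 ltr_pM2l ?ltr0n.
have cell_lt (x : rat) : (`|Num.floor (m%:R * (x - (Num.floor x)%:~R))| < m)%N.
  by have := cell0 x; lia.
pose cell t := [ffun j => Ordinal (cell_lt (t%:R * q j))].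
have [t1 [t2 [t12 t2B /ffunP cellE]]] := pigeonhole cell.
exists (t2 - t1)%N; split; first by rewrite subn_gt0.
  exact: leq_trans (leq_subr _ _) t2B.
exists (fun j => Num.floor (t2%:R * q j) - Num.floor (t1%:R * q j)).
have -> : (t2 - t1)%:R * a - \sum_j (Num.floor (t2%:R * q j) - Num.floor (t1%:R * q j))%:~R *: e j
  = \sum_j ((t2%:R * q j - (Num.floor (t2%:R * q j))%:~R) - (t1%:R * q j - (Num.floor (t1%:R * q j))%:~R)) *: e j.
  rewrite aE mulr_sumr -sumrB; apply: eq_bigr => j _.
  rewrite mulr_natl -scaler_nat scalerA -scalerBl; congr (_ *: _).
  by rewrite natrB ?(ltnW t12) // intrB mulrBl; ring.
apply: small => j; have := cellE j; rewrite !ffunE => /(congr1 val) /= cE.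
have := cell0 (t1%:R * q j); have := cell0 (t2%:R * q j).
set x1 := t1%:R * q j; set x2 := t2%:R * q j.
set f1 := x1 - _; set f2 := x2 - _ => c2 c1.
have {cE} cE : Num.floor (m%:R * f1) = Num.floor (m%:R * f2) by move: cE c1 c2; rewrite -/f1 -/f2; lia.
have := floor_itv (m%:R * f1); have := floor_itv (m%:R * f2); rewrite cE intrD.
set z := (Num.floor _)%:~R => /andP[z1 z2] /andP[z3 z4].
rewrite -[X in _ * X]normr_nat -normrM mulrBl ler_norml.
by apply/andP; split; lra.
Qed.

End Lattice.

Section ClassNumber.
Variable L : fieldExtType rat.
Local Notation d := (\dim {:L}).

(** When the ideal (A) is the N-th power of an ideal, this is that ideal. *)
Definition root_ideal (N : nat) (A : L) : set L :=
  [set y | forall V, is_valuation_ring V -> V (y ^+ N / A)]%classic.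

Section RootIdeal.
Variables (N : nat) (A : L).
Hypotheses (N0 : (0 < N)%N) (A0 : A != 0).

Lemma root_ideal0 : root_ideal N A 0.
Proof.
by move=> V [ringV _]; rewrite expr0n eqn0Ngt N0 mul0r; apply: subring0.
Qed.

Lemma root_idealM x y :
  (forall V, is_valuation_ring V -> V x) -> root_ideal N A y -> root_ideal N A (x * y).
Proof.
move=> Ox Iy V valV; have [ringV _] := valV; rewrite exprMn -mulrA.
by apply: (subringM ringV); [apply: valringX => //; exact: Ox | exact: (Iy V valV)].
Qed.

Lemma root_idealB x y : root_ideal N A x -> root_ideal N A y -> root_ideal N A (x - y).
Proof.
move=> Ix Iy V valV; have [ringV totV] := valV.
have [->|x0] := eqVneq x 0.
  by rewrite sub0r -mulN1r; apply: root_idealM => // V' [ringV' _]; apply: subringN => //; exact: subring1.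
have [->|y0] := eqVneq y 0; first by rewrite subr0; exact: (Ix V valV).
have key u v : u != 0 -> V (u ^+ N / A) -> V (v / u) -> V ((u - v) ^+ N / A).
  move=> u0 Vu Vvu; have -> : (u - v) ^+ N / A = (1 - v / u) ^+ N * (u ^+ N / A).
    by rewrite mulrA -exprMn mulrBl mul1r divfK.
  apply: (subringM ringV) => //; apply: valringX => //; apply: subringB => //.
  exact: subring1.
have [h|] := totV (x / y); last by rewrite invf_div => h; apply: key => //; exact: (Ix V valV).
rewrite -opprB -mulN1r exprMn -mulrA; apply: (subringM ringV).
  by apply: valringX => //; apply: subringN => //; exact: subring1.
by apply: key => //; exact: (Iy V valV).
Qed.

(** f ^ N / A is integral after multiplication by a unit b of V, and then so is
(b * f) ^ N / A. *)
Lemma root_ideal_attained V f : is_valuation_ring V -> f != 0 -> V (f ^+ N / A) ->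
  exists2 y, vunit V (y / f) & root_ideal N A y.
Proof.
move=> valV f0 Vf; have [b [Ub bO]] := integral_denominator valV Vf.
exists (b * f) => [|V' valV']; first by rewrite mulfK.
have [V'b V'bf] := bO V' valV'; have [ringV' _] := valV'.
rewrite exprMn -(prednK N0) exprSr -!mulrA [f ^+ _.+1]exprS -exprS prednK //.
by apply: (subringM ringV') => //; apply: valringX.
Qed.

(** A minimum exists because N(y) ^ N / N(A) is an integer for every y in the ideal. *)
Lemma root_ideal_min : exists y, [/\ y != 0, root_ideal N A y &
  forall z, root_ideal N A z -> `|rnorm z| < `|rnorm y| -> z = 0].
Proof.
have val1 : is_valuation_ring (setT : set L) by split=> // x; left.
pose mu y := `|Num.floor (rnorm (y ^+ N / A))|%N.
pose P m := `[< exists y, [/\ y != 0, root_ideal N A y & mu y = m] >].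
have exP : exists m, P m.
  have [y [+ _ _] Iy] := root_ideal_attained val1 (oner_neq0 L) I.
  rewrite divr1 => y0.
  by exists (mu y); apply/asboolP; exists y.
have [_ /asboolP[y [y0 Iy <-]] miny] := ex_minnP exP.
exists y; split=> // z Iz ltzy; apply/eqP; apply: contraTT ltzy => z0.
have := miny (mu z); rewrite -leNgt => H.
have {}H : (mu y <= mu z)%N by apply: H; apply/asboolP; exists z.
have muE w : root_ideal N A w -> (mu w)%:R = `|rnorm w| ^+ N * `|rnorm A^-1|.
  move=> /int_rnorm_integral zw; rewrite /mu natr_absz.
  by rewrite intr_norm /= floorK // rnormM rnormX normrM normrX.
move: H; rewrite -(ler_nat rat) !muE // ler_pM2r ?normr_gt0 ?rnorm_eq0 ?invr_eq0 //.
by rewrite ler_pXn2r // nnegrE.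
Qed.

End RootIdeal.

(** Finiteness of the class group. If y is an element of least norm in an ideal I, the
fractional ideal I / y lies between a lattice E and a multiple E / Q of it
with Q independent of I, which leaves finitely many possibilities for I / y.
So among the ideals I_0, ..., I_h, where I_j is the N-th root of (W ^ j), two differ
by a factor z. Where (W) is not an N-th power I_j says nothing about W, hence
the restriction to the rings V with an f. *)
Lemma class_group_exponent : exists2 h : nat, (0 < h)%N &
  forall (N : nat) (W : L), (0 < N)%N -> W != 0 ->
  exists k z, [/\ (0 < k)%N, (k <= h)%N, z != 0 &
    forall V f, is_valuation_ring V -> f != 0 -> vunit V (W / f ^+ N) ->
      vunit V (W ^+ k / z ^+ N)].
Proof.
have [D D0 Db] := common_denominator (vbasis {:L}).
pose e (j : 'I_d) : L := (D%:R : rat) *: (vbasis {:L})`_j.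
have int_e j : int_mulmat (e j) by apply: Db; apply: mem_nth; rewrite size_tuple.
have gen_e x : exists q : 'I_d -> rat, x = \sum_j q j *: e j.
  exists (fun j => coord (vbasis {:L}) j x / D%:R).
  rewrite {1}[x]vbasis_coordE; apply: eq_bigr => j _.
  by rewrite scalerA divfK // pnatr_eq0 -lt0n.
have [B B0 approx] := lattice_approximation gen_e.
pose Q := B`!; have Q0 : (0 < Q)%N by apply: fact_gt0.
pose T := {set {ffun 'I_d -> 'I_Q}}.
exists #|{: T}| => [|N W N0 W0].
  by apply/card_gt0P; exists finset.set0.
have W0j j : W ^+ j != 0 by apply: expf_neq0.
have /choice[y yP] : forall j, exists y, [/\ y != 0, root_ideal N (W ^+ j) y &
    forall z, root_ideal N (W ^+ j) z -> `|rnorm z| < `|rnorm y| -> z = 0].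
  by move=> j; apply: root_ideal_min.
pose pt (c : {ffun 'I_d -> 'I_Q}) : L := \sum_j ((c j)%:R / Q%:R : rat) *: e j.
(* S j determines root_ideal N (W ^ j) up to the factor y_j *)
pose S j : T := [set c | `[< root_ideal N (W ^+ j) (y j * pt c) >]].
have [i [j [ij jT Sij]]] := pigeonhole S.
have transport k l : S k = S l -> forall x,
    root_ideal N (W ^+ k) x -> root_ideal N (W ^+ l) (y l / y k * x).
  move=> Skl x Ix; have [yk0 Iyk miny] := yP k; have [yl0 Iyl _] := yP l.
  have [t [t0 tB [c cE]]] := approx (x / y k).
  have lat0 : t%:R * x - y k * \sum_j (c j)%:~R *: e j = 0.
    apply: miny.
      apply: root_idealB => //; first by apply: root_idealM => // V valV; exact: valring_nat.
      rewrite mulrC; apply: root_idealM => // V valV; apply: int_mulmat_valring => //.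
      exact: int_lattice.
    have -> : t%:R * x - y k * \sum_j (c j)%:~R *: e j
       = (t%:R * (x / y k) - \sum_j (c j)%:~R *: e j) * y k.
      by rewrite mulrBl mulrA divfK // [_ * y k]mulrC.
    rewrite rnormM normrM -[X in _ < X]mul1r ltr_pM2r //.
    by rewrite normr_gt0 rnorm_eq0.
  have [r QE] : exists r, Q = (r * t)%N by apply/dvdnP/dvdn_fact; rewrite t0.
  pose c' s := (c s * r%:Z)%R.
  have Q0r : Q%:R != 0 :> rat by rewrite pnatr_eq0 -lt0n.
  have modQ s : (`|(c' s %% Q)%Z| < Q)%N.
    have := modz_ge0 (c' s) (d := Q); have := ltz_pmod (c' s) (d := Q); lia.
  (* x / y_k = l0 + pt c0 with l0 in the lattice and pt c0 in a set independent of x *)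
  pose c0 : {ffun 'I_d -> 'I_Q} := [ffun s => Ordinal (modQ s)].
  pose l0 : L := \sum_s (c' s %/ Q)%Z%:~R *: e s.
  have xE : x / y k = l0 + pt c0.
    have t0r : t%:R != 0 :> L by rewrite pmulrn intr_alg_eq0 -lt0n.
    have -> : x / y k = t%:R^-1 * \sum_j (c j)%:~R *: e j.
      apply: (canLR (mulfK yk0)); rewrite -mulrA; apply: (canRL (mulKf t0r)).
      by rewrite (subr0_eq lat0) mulrC.
    have -> : t%:R^-1 = (t%:R^-1 : rat)%:A :> L.
      by rewrite -[RHS]/(in_alg L _) fmorphV rmorph_nat.
    rewrite mulr_algl scaler_sumr -big_split /=; apply: eq_bigr => l' _.
    rewrite scalerA -scalerDl ffunE /=; congr (_ *: _).
    have t0q : t%:R != 0 :> rat by rewrite pnatr_eq0 -lt0n.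
    apply: (mulfI Q0r); rewrite mulrDr [_ * (_ / _)]mulrC divfK // {1}QE natrM.
    rewrite natr_absz ger0_norm; last by apply: modz_ge0; lia.
    have := divz_eq (c' l') Q => /(congr1 (intr : int -> rat)); rewrite intrD intrM => cE'.
    by rewrite [_ * (_ %/ _)%Z%:~R]mulrC -cE' /c' intrM mulrA mulfK // mulrC.
  have Il0 : root_ideal N (W ^+ k) (y k * l0).
    rewrite mulrC; apply: root_idealM => // V valV; apply: int_mulmat_valring => //.
    exact: int_lattice.
  have : c0 \in S k.
    rewrite inE; apply/asboolP.
    have -> : y k * pt c0 = x - y k * l0.
      by rewrite -[x](divfK yk0) xE mulrDl -!(mulrC (y k)) addrAC subrr add0r.
    exact: root_idealB.
  rewrite Skl inE => /asboolP Ic0.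
  rewrite -mulrA (mulrC _^-1) xE mulrDr -[y l * pt c0]opprK; apply: root_idealB => //.
    rewrite mulrC; apply: root_idealM => // V valV; apply: int_mulmat_valring => //.
    exact: int_lattice.
  by rewrite -sub0r; apply: root_idealB => //; apply: root_ideal0.
exists (j - i)%N, (y j / y i).
have [[yi0 _ _] [yj0 _ _]] := conj (yP i) (yP j).
have z0 : y j / y i != 0 by rewrite mulf_neq0 ?invr_eq0.
split=> //; first by rewrite subn_gt0.
  exact: leq_trans (leq_subr _ _) jT.
move=> V f valV f0 UWf; have [ringV _] := valV.
pose z k l := y l / y k.
have key k l : S k = S l -> V (z k l ^+ N * W ^+ k / W ^+ l).
  move=> Skl; have Ufk : vunit V ((f ^+ k) ^+ N / W ^+ k).
    rewrite -exprM mulnC exprM -expr_div_n; apply: vunitX => //.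
    by rewrite -invf_div; apply: vunitV.
  have fk0 : f ^+ k != 0 by apply: expf_neq0.
  have [x [x0 Vx Vxi] Ix] := root_ideal_attained N0 valV fk0 (let: And3 _ h _ := Ufk in h).
  have x0' : x != 0 by apply: contraNneq x0 => ->; rewrite mul0r.
  have /= := transport k l Skl x Ix V valV.
  rewrite -/(z k l) => Vzx.
  have -> : z k l ^+ N * W ^+ k / W ^+ l
     = ((z k l * x) ^+ N / W ^+ l) * ((x / f ^+ k)^-1) ^+ N * (((f ^+ k) ^+ N / W ^+ k))^-1.
    have := (expf_neq0 N x0', expf_neq0 N fk0, W0j k, W0j l).
    rewrite !invf_div [(_ / x) ^+ N]expr_div_n [(_ * x) ^+ N]exprMn.
    move: (W ^+ k) (W ^+ l) ((f ^+ k) ^+ N) (x ^+ N) (z k l ^+ N) => A A' F X Z.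
    by move=> [[[X0 F0] A0] A'0]; field; rewrite ?A0 ?A'0 ?X0 ?F0.
  apply: (subringM ringV); last by have [] := Ufk.
  by apply: (subringM ringV) => //; apply: valringX.
have zV : z j i = (z i j)^-1 by rewrite /z invf_div.
have WE : W ^+ (j - i) = W ^+ j / W ^+ i.
  by apply: (canRL (mulfK (W0j i))); rewrite -exprD subnK // ltnW.
split; first by rewrite mulf_neq0 ?expf_neq0 // invr_eq0 expf_neq0.
  have := key j i (esym Sij); rewrite zV exprVn WE /z.
  by rewrite mulrC mulrA [X in V (X / _)]mulrC -mulrA [X in V (_ * X)]mulrC mulrA.
have := key i j Sij; rewrite WE /z invf_div -mulrA; congr (V _); congr (_ * _).
by rewrite invf_div.
Qed.

End ClassNumber.

(** * Fields generated by roots of unity *)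

Section RootsOfUnity.
Variables (K : fieldType) (p k : nat) (z : K).
Hypothesis prim_z : (p ^ k)%N.-primitive_root z.
Local Notation q := (p ^ k)%N.

Lemma prod_one_sub_prim_root : \prod_(1 <= i < q) (1 - z ^+ i) = q%:R.
Proof.
have q0 := prim_order_gt0 prim_z.
have := factor_Xn_sub_1 prim_z; rewrite big_ltn // expr0 -[X in 'X - X]/(1%:P).
rewrite subrX1 => /mulfI H; have {H} := H (negbT (polyXsubC_eq0 1)).
move/(congr1 (horner^~ 1)); rewrite horner_prod horner_sum.
rewrite (eq_bigr (fun i => 1 - z ^+ i)) => [->|i _]; last by rewrite !hornerE.
rewrite (eq_bigr (fun=> 1)) => [|i _]; last by rewrite hornerXn expr1n.
by rewrite sumr_const card_ord.
Qed.

Variable V : set K.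
Hypotheses (valV : is_valuation_ring V) (Vp : V p%:R^-1).
Let ringV : is_subring V. Proof. by case: valV. Qed.

Lemma prim_root_valring : V z.
Proof.
apply: (valring_root valV (prim_order_gt0 prim_z)).
by rewrite prim_expr_order //; apply: subring1.
Qed.

(** 1 - z ^ i divides p ^ k, which is a unit away from p. *)
Lemma vunit_one_sub_root i : z ^+ i != 1 -> vunit V (1 - z ^+ i).
Proof.
move=> zi1; have q0 := prim_order_gt0 prim_z.
have qi : (0 < i %% q)%N by rewrite lt0n -/(dvdn q i) (prim_order_dvd prim_z).
have Vz j : V (1 - z ^+ j).
  by apply: subringB => //; [exact: subring1 | apply: valringX => //; exact: prim_root_valring].
rewrite -(prim_expr_mod prim_z); set j := (i %% q)%N in qi *.
have jq : (j < q)%N by rewrite ltn_mod.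
have := prod_one_sub_prim_root; rewrite (bigD1_seq j) ?iota_uniq //=; last first.
  by rewrite mem_index_iota qi.
set R := \prod_(_ <- _ | _) _ => qE.
have VR : V R.
  by rewrite /R; elim/big_rec: _ => [|l x _ Vx]; [exact: subring1 | exact: subringM].
have x0 : 1 - z ^+ j != 0 by rewrite subr_eq0 eq_sym /j prim_expr_mod.
split=> //.
have q0' := prim_root_natf_neq0 prim_z.
have -> : (1 - z ^+ j)^-1 = R * p%:R^-1 ^+ k.
  apply: (mulfI x0); rewrite mulfV // mulrA qE exprVn -natrX mulfV //.
by apply: (subringM ringV) => //; apply: valringX.
Qed.

End RootsOfUnity.

Lemma p_unit_root p (K : fieldType) (x : K) n : (0 < n)%N -> is_p_unit p (x ^+ n) -> is_p_unit p x.
Proof.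
move=> n0 /p_unit_vunit[xn0 Ux]; apply/p_unit_vunit.
split; first by move: xn0; rewrite expf_eq0 n0.
by move=> V valV Vp; apply: (vunit_root valV n0); apply: Ux.
Qed.

Lemma is_p_unitX p (K : fieldType) (x : K) n : is_p_unit p x -> is_p_unit p (x ^+ n).
Proof.
by move=> Ux; elim: n => [|n IH]; rewrite ?expr0 ?exprS; [exact: is_p_unit1 | exact: is_p_unitM].
Qed.

Section Unramified.
Variables (F : fieldExtType rat) (k0 L : splittingFieldType F) (i : 'AHom(k0, L)).
Variables (p k : nat) (z : L).
Hypotheses (prim_z : (p ^ k)%N.-primitive_root z) (gen_z : <<1; z>>%VS = fullv).
Local Notation G := 'Gal({:L} / limg i)%g.

Lemma gal_fix_gen (s : gal_of {:L}) : s z = z -> s = 1%g.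
Proof.
move=> sz; apply/eqP/gal_eqP => x _; rewrite gal_id.
have : x \in <<1; z>>%VS by rewrite gen_z memvf.
case/Fadjoin_polyP => q Kq ->; rewrite -horner_map /= sz; congr (_.[_]).
by apply: (fixedPoly_gal (sub1v _)) => //; rewrite gal_kHom ?sub1v // k1AHom.
Qed.

(** k0(z) / k0 is unramified at a place V not above p, because the differences of the
conjugates of z are units there. Interpolation on the conjugates of z therefore gives a
polynomial sum_l f_l X^l over V with value 1 at z and 0 at the others, so e is the
sum of the f_l T_l where T_l is the trace of z ^ l * e. As the conjugates of e
differ from e by units, T_l / e is in V, and it is a unit for some l. *)
Lemma unramified_root (N : nat) (a : k0) (e u : L) (V : set L) :
  (0 < N)%N -> a != 0 -> i a = e ^+ N * u -> is_p_unit p u ->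
  is_valuation_ring V -> V p%:R^-1 ->
  exists2 f : k0, f != 0 & vunit V (i (a / f ^+ N)).
Proof.
move=> N0 a0 aE Uu valV Vp; have [ringV _] := valV.
have ia0 : i a != 0 by rewrite fmorph_eq0.
have e0 : e != 0.
  by apply: contraNneq ia0 => e0; rewrite aE e0 expr0n eqn0Ngt N0 mul0r.
have Gfix s x : s \in G -> s (i x) = i x.
  by move=> Gs; apply: (fixed_gal (subvf _) Gs); apply: memv_img; apply: memvf.
have conj_e (s : gal_of {:L}) : s \in G -> vunit V (s e / e).
  move=> Gs; have : is_p_unit p ((s e / e) ^+ N).
    have [u0 _] := Uu; have su0 : s u != 0 by rewrite fmorph_eq0.
    have -> : (s e / e) ^+ N = u * (s u)^-1.
      rewrite expr_div_n; apply: (canLR (mulfK (expf_neq0 N e0))).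
      apply: (mulIf su0); rewrite mulrAC divfK // [u * _]mulrC -aE.
      by rewrite -[RHS](Gfix s) // aE rmorphM rmorphXn.
    by apply: is_p_unitM => //; apply/is_p_unitV/(is_p_unit_rmorph p (gal_repr s) u).2.
  by move=> /(p_unit_root N0)/p_unit_vunit[_]; apply.
have Vz (s : gal_of {:L}) l : V (s z ^+ l).
  apply: valringX => //; apply: (@prim_root_valring _ p k) => //.
  by rewrite fmorph_primitive_root.
pose T l := galTrace (limg i) {:L} (z ^+ l * e).
have VT l : V (T l / e).
  rewrite /T /galTrace mulr_suml; apply: subring_sum => // s Gs.
  rewrite rmorphM rmorphXn -mulrA; apply: (subringM ringV); first exact: Vz.
  by have [] := conj_e s Gs.
have conj_z (s : gal_of {:L}) : s != 1%g -> vunit V (z - s z).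
  move=> s1; have [j _ szE] := aut_prim_rootP (gal_repr s) prim_z.
  have jE : s z = z * z ^+ (j + (p ^ k).-1).
    by rewrite -exprS -addnS prednK ?(prim_order_gt0 prim_z) // exprD (prim_expr_order prim_z) mulr1.
  rewrite jE -{1}[z]mulr1 -mulrBr; apply: vunitM => //.
    split; [by rewrite (prim_root_eq0 prim_z) -lt0n (prim_order_gt0 prim_z) | exact: prim_root_valring prim_z _ _ |].
    have -> : z^-1 = z ^+ (p ^ k).-1.
      apply: (@mulfI _ z); first by rewrite (prim_root_eq0 prim_z) -lt0n (prim_order_gt0 prim_z).
      rewrite mulfV; first by rewrite -exprS prednK ?(prim_order_gt0 prim_z) // prim_expr_order.
      by rewrite (prim_root_eq0 prim_z) -lt0n (prim_order_gt0 prim_z).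
    by apply: valringX => //; apply: prim_root_valring prim_z _ _.
  apply: (vunit_one_sub_root prim_z) => //; apply: contra s1 => /eqP zj.
  by apply/eqP/gal_fix_gen; rewrite jE zj mulr1.
pose f := \prod_(s : gal_of {:L} | (s \in G) && (s != 1%g)) ((z - s z)^-1 *: ('X - (s z)%:P)).
have Vf : polyin V f.
  rewrite /f; elim/big_rec: _ => [|s h /andP[Gs s1] Vh]; first by apply: polyinC => //; exact: subring1.
  apply: polyinM => //; rewrite -mul_polyC; apply: polyinM => //.
    by apply: polyinC => //; have [] := conj_z s s1.
  by apply: polyinB => //; [exact: polyinX | apply: polyinC => //; have := Vz s 1%N; rewrite expr1].
have f_conj (s : gal_of {:L}) : s \in G -> f.[s z] = (s == 1%g)%:R.
  move=> Gs; rewrite horner_prod; have [->|s1] := eqVneq s 1%g.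
    rewrite gal_id big1 // => t /andP[_ t1]; rewrite !hornerE mulVf //.
    by have [] := conj_z t t1.
  by rewrite (bigD1 s) ?Gs //= !hornerE subrr mulr0 mul0r.
have eE : 1 = \sum_(l <- index_iota 0 (size f)) f`_l * (T l / e).
  apply: (mulIf e0); rewrite mul1r mulr_suml.
  transitivity (\sum_(s in G) s e * f.[s z]).
    rewrite (bigD1 1%g) ?group1 //= f_conj ?group1 // eqxx mulr1 gal_id.
    by rewrite big1 ?addr0 // => s /andP[Gs s1]; rewrite f_conj // (negPf s1) mulr0.
  rewrite big_mkord; under eq_bigr => s _ do rewrite horner_coef mulr_sumr.
  rewrite exchange_big /=; apply: eq_bigr => l _; rewrite -mulrA divfK // /T /galTrace mulr_sumr.
  by apply: eq_bigr => s _; rewrite rmorphM rmorphXn mulrCA; congr (_ * _); rewrite mulrC.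
have [||l _ Ul] := @vunit_sum _ _ valV _ (index_iota 0 (size f)) (fun l => f`_l * (T l / e)).
- by move=> l _; apply: (subringM ringV).
- by rewrite -eE; apply: vunit1.
have {Ul} UT : vunit V (T l / e).
  have [lT0 _ VTi] := Ul; have [f0 T0] : f`_l != 0 /\ T l / e != 0.
    by move: lT0; rewrite mulf_eq0 negb_or => /andP.
  split=> //; rewrite -[_^-1]mul1r -{1}(mulfV f0) -mulrA -invfM.
  exact: (subringM ringV).
have /memv_imgP[f0 _ f0E] : T l \in limg i.
  exact: (@mem_galTrace F L [aspace of limg i] [aspace of {:L}] _ (galois_ahom i) (memvf _)).
have T0 : T l != 0 by have [+ _ _] := UT; rewrite mulf_eq0 negb_or => /andP[].
have f00 : f0 != 0 by apply: contraNneq T0; rewrite f0E => ->; rewrite linear0.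
exists f0 => //.
have -> : i (a / f0 ^+ N) = u * ((T l / e)^-1) ^+ N.
  rewrite invf_div expr_div_n rmorphM fmorphV rmorphXn /= -f0E aE.
  by rewrite mulrA; congr (_ / _); rewrite mulrC.
apply: vunitM => //; first by have /p_unit_vunit[_] := Uu; apply.
by apply: vunitX => //; apply: vunitV.
Qed.

End Unramified.

(** A field generated by a root of unity z splits X ^ n - 1, so Galois theory becomes
available once E is replaced by its subfield F(z). *)
Lemma cyclotomic_splitting_field (F : fieldType) (k0 : splittingFieldType F)
    (E : fieldExtType F) (n : nat) (z : E) (h : 'AHom(k0, E)) :
  n.-primitive_root z -> (limg h <= <<1; z>>)%VS ->
  exists (L : splittingFieldType F) (z' : L) (h' : 'AHom(k0, L)),
    n.-primitive_root z' /\ <<1; z'>>%VS = fullv.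
Proof.
move=> prim_z hz; pose L0 : fieldExtType F := subvs_of <<1; z>>%AS.
pose v : {lrmorphism L0 -> E} := vsval.
have v_inj : injective v by apply: subvs_inj.
pose z' : L0 := Subvs (memv_adjoin 1 z).
have prim_z' : n.-primitive_root z' by rewrite -(fmorph_primitive_root v).
have gen_z' : <<1; z'>>%VS = fullv.
  apply/eqP; rewrite eqEsubv subvf; apply/subvP => x _.
  have : v x \in <<1; z>>%VS by apply: subvsP.
  case/Fadjoin1_polyP => q vxE; apply/Fadjoin1_polyP; exists q.
  apply: v_inj; rewrite [LHS]vxE -horner_map -map_poly_comp; congr (_.[_]).
  by apply: eq_map_poly => a; exact: esym (rmorph_alg v a).
have ax : splitting_field_axiom L0.
  exists ('X^n - 1); first by rewrite rpredB ?rpredX ?polyOverX ?rpred1.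
  exists [seq z' ^+ i | i <- index_iota 0 n].
    by rewrite big_map (factor_Xn_sub_1 prim_z') eqpxx.
  apply/eqP; rewrite eqEsubv subvf /= -gen_z'; apply/FadjoinP; split.
    exact: subv_adjoin_seq.
  apply: seqv_sub_adjoin; have [n1|n1] := eqVneq n 1%N.
    have := prim_expr_order prim_z'; rewrite n1 expr1 => ->.
    by apply/mapP; exists 0%N; rewrite ?expr0 // mem_iota.
  apply/mapP; exists 1%N; rewrite ?expr1 // mem_index_iota /=.
  by rewrite ltn_neqAle eq_sym n1 (prim_order_gt0 prim_z').
pose L : splittingFieldType F := HB.pack L0 (FieldExt_isSplittingField.Build F L0 ax).
have hE x : h x \in <<1; z>>%VS by apply: (subvP hz); apply: memv_img; apply: memvf.
pose g x : L0 := Subvs (hE x).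
have gE x : v (g x) = h x by [].
have gB : zmod_morphism g by move=> x y; apply: v_inj; rewrite [RHS]rmorphB; exact: rmorphB.
have gM : monoid_morphism g.
  split; first by apply: v_inj; rewrite [RHS]rmorph1; exact: rmorph1.
  by move=> x y; apply: v_inj; rewrite [RHS]rmorphM; exact: rmorphM.
have gZ : scalable g.
  by move=> a x; apply: v_inj; rewrite [RHS]linearZ; exact: linearZ.
pose gL : {lrmorphism k0 -> L0} := HB.pack g (GRing.isZmodMorphism.Build k0 L0 g gB)
  (GRing.isMonoidMorphism.Build k0 L0 g gM) (GRing.isScalable.Build F k0 L0 *:%R g gZ).
have hom : ahom_in {:k0} (linfun gL) by exact: linfun_is_ahom.
by exists L, z', (AHom hom).
Qed.

(** The minimal polynomial of z over the rationals has a complex root w, which satisfies the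
same relations w ^ m = 1 as z. So w is a primitive n-th root of unity as well, and its
minimal polynomial is the cyclotomic one, of degree totient n. *)
Lemma totient_leq_dim (L : fieldExtType rat) (n : nat) (z : L) :
  n.-primitive_root z -> (totient n <= \dim {:L})%N.
Proof.
move=> prim_z; have n0 := prim_order_gt0 prim_z.
have dvdp_root (K : fieldType) (a b : {poly K}) x : a %| b -> root a x -> root b x.
  by case/dvdpP => r -> ax; rewrite rootM ax orbT.
have [/polyOver1P[q qE] rq] := (minPolyOver 1 z, root_minPoly 1 z).
have sq : (1 < size q)%N by rewrite -(size_map_poly (in_alg L)) -qE size_minPoly.
pose QC : {poly rat} -> {poly algC} := map_poly ratr.
have [w wq] : exists w, root (QC q) w.
  by apply/closed_rootP; rewrite size_map_poly gtn_eqF.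
have [pw [pwE _] wP] := minCpolyP w.
have pwq : pw %| q by rewrite -wP.
have spw : (1 < size pw)%N by rewrite -(size_map_poly (ratr : rat -> algC)) -pwE size_minCpoly.
have zpw : root (map_poly (in_alg L) pw) z.
  have : map_poly (in_alg L) pw %| minPoly 1 z by rewrite qE dvdp_map.
  case/minPoly_irr/orP; first by apply/polyOver1P; exists pw.
    by move=> /eqp_root ->.
  by rewrite -size_poly_eq1 size_map_poly gtn_eqF.
have dvd_of m : w ^+ m = 1 -> z ^+ m = 1.
  move=> wm; have : pw %| 'X^m - 1.
    by rewrite -wP rmorphB /= map_polyXn rmorph1 rootE !hornerE wm subrr.
  rewrite -(dvdp_map (in_alg L)) => /dvdp_root /(_ zpw).
  by rewrite rmorphB /= map_polyXn rmorph1 rootE !hornerE subr_eq0 => /eqP.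
have wn : w ^+ n = 1.
  have : q %| 'X^n - 1.
    rewrite -(dvdp_map (in_alg L)) -qE minPoly_dvdp //; first by apply/polyOver1P; exists ('X^n - 1).
    by rewrite rmorphB /= map_polyXn rmorph1 rootE !hornerE (prim_expr_order prim_z) subrr.
  rewrite -(dvdp_map (ratr : rat -> algC)) => /dvdp_root /(_ wq).
  by rewrite rmorphB /= map_polyXn rmorph1 rootE !hornerE subr_eq0 => /eqP.
have [m prim_w mn] := prim_order_exists n0 wn.
have nm : n = m.
  apply/eqP; rewrite eqn_dvd mn andbT (prim_order_dvd prim_z).
  by rewrite dvd_of ?(prim_expr_order prim_w).
apply: (@leq_trans (size q).-1).
  rewrite -ltnS prednK ?(ltnW sq) // -size_Cyclotomic nm.
  have -> : size 'Phi_m = size pw.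
    rewrite -(size_map_poly (ratr : rat -> algC)) -pwE (minCpoly_cyclotomic prim_w).
    by rewrite size_cyclotomic size_Cyclotomic.
  by apply: dvdp_leq => //; rewrite -size_poly_gt0 ltnW.
rewrite -(size_map_poly (in_alg L) q) -qE size_minPoly /=.
by rewrite /adjoin_degree dimv1 divn1 prednK ?adim_gt0 // dimvS ?subvf.
Qed.

(** totient (p ^ r) is unbounded in r. *)
Lemma p_torsion_exponent (L : fieldExtType rat) (p : nat) : prime p ->
  exists s : nat, forall (m : nat) (x : L), x ^+ (p ^ m) = 1 -> x ^+ (p ^ s) = 1.
Proof.
move=> p_pr; exists (\dim {:L}) => m x xm.
have [|l prim_x /(dvdn_pfactor _ _ p_pr)[j _ lE]] := prim_order_exists _ xm.
  by rewrite expn_gt0 prime_gt0.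
have : (j <= \dim {:L})%N.
  case: j lE => [|j] lE; first exact: leq0n.
  apply: leq_trans (totient_leq_dim prim_x); rewrite lE totient_pfactor //.
  apply: (@leq_trans (p ^ j)); first by apply: ltn_expl; apply: prime_gt1.
  by rewrite leq_pmull // -subn1 subn_gt0 prime_gt1.
move=> /subnK <-; rewrite addnC expnD exprM -lE (prim_expr_order prim_x) expr1n //.
Qed.

(** * Automorphisms and norms in the tower *)

Section GaloisGroup.
Variables (F : fieldExtType rat) (L : splittingFieldType F).

Lemma galois_full : galois 1 {:L}.
Proof.
rewrite /galois subvf normalFieldf andbT; apply/separableP => x _.
apply: (@pcharf0_separable F L 1%AS) => q.
by rewrite (pchar_lalg L) (pchar_lalg F) pchar_num.
Qed.

Lemma mem_gal_full (s : gal_of {:L}) : s \in 'Gal({:L} / 1)%g.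
Proof. by rewrite gal_kHom ?sub1v // k1AHom. Qed.

Lemma card_gal_full : #|'Gal({:L} / 1)%g| = \dim {:L}.
Proof. by rewrite -(galois_dim galois_full) dimv1 divn1. Qed.

Lemma galNorm_cycle (U : {vspace L}) (g : gal_of {:L}) (x : L) :
  'Gal({:L} / U)%g = <[g]>%g ->
  galNorm U {:L} x = \prod_(j < #[g]%g) (g ^+ j)%g x.
Proof.
move=> HE; rewrite /galNorm HE.
have -> : <[g]>%g = [set (g ^+ (i : 'I_#[g]%g))%g | i in 'I_#[g]%g].
  apply/setP => t; apply/idP/imsetP => [/cycleP[i ->]|[i _ ->]]; last exact: mem_cycle.
  have lti : (i %% #[g]%g < #[g]%g)%N by rewrite ltn_mod order_gt0.
  by exists (Ordinal lti) => //=; rewrite expg_mod_order.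
rewrite big_imset //= => i j _ _ /eqP; rewrite eq_expg_mod_order !modn_small //.
by move/eqP/val_inj.
Qed.

End GaloisGroup.

Section Automorphisms.
Variables (p : nat) (F : fieldExtType rat) (T : Zp_extension p F).

Lemma layer_restr_surj n (s : layer_gal T n) : exists t : layer_gal T n.+1, layer_restr t = s.
Proof.
pose i := layer_incl T n.
have iK : lker i == 0%VS by apply: AHom_lker0.
pose f : 'End(layer T n.+1) := (i \o (gal_repr s \o i^-1))%VF.
have fE x : f (i x) = i (s x) by rewrite !lfunE /= !lfunE /= lker0_lfunK.
have kf : kHom 1 (limg i) f.
  rewrite k1HomE; apply/ahom_inP; split; last by rewrite -(rmorph1 i) fE !rmorph1.
  move=> _ _ /memv_imgP[x _ ->] /memv_imgP[y _ ->].
  by rewrite -rmorphM !fE !rmorphM.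
have [g gE] := kHom_to_AEnd (K := 1%AS) (E := [aspace of limg i]) kf.
exists (gal {:layer T n.+1} g); apply: layer_restr_eq => x.
rewrite galK ?memvf ?subvf // -fE gE //.
by apply: memv_img; apply: memvf.
Qed.

Lemma layer_emb_le n m (x : layer T n) : (n <= m)%N ->
  exists y : layer T m, layer_emb T m y = layer_emb T n x.
Proof.
move=> /subnK <-; elim: (m - n)%N => [|k [y yE]]; first by exists x.
by exists (layer_incl T _ y); rewrite layer_emb_incl.
Qed.

(** Restriction between consecutive layers is surjective, so s lifts to a
compatible family on the layers above, which glues to an automorphism of the union. *)
Lemma layer_gal_lift n (s : layer_gal T n) :
  exists S : Gal_inf T, forall x, S (layer_emb T n x) = layer_emb T n (s x).
Proof.
pose lift m (t : layer_gal T m) : layer_gal T m.+1 := sval (cid (layer_restr_surj t)).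
have liftE m (t : layer_gal T m) : layer_restr (lift m t) = t by apply: (svalP (cid (layer_restr_surj t))).
(* the index k + n makes the successor step definitional *)
pose t := fix t k : layer_gal T (k + n) :=
  if k is k'.+1 then lift (k' + n)%N (t k') else s.
have tS k x : layer_incl T _ (t k x) = t k.+1 (layer_incl T _ x).
  by rewrite -layer_restrE /= liftE.
have glue k x m y : layer_emb T (k + n) x = layer_emb T (m + n) y ->
    layer_emb T (k + n) (t k x) = layer_emb T (m + n) (t m y).
  have up l j z : exists2 w, layer_emb T (j + l + n) w = layer_emb T (l + n) z &
      layer_emb T (j + l + n) (t (j + l)%N w) = layer_emb T (l + n) (t l z).
    elim: j => [|j [w wE twE]]; first by exists z.
    exists (layer_incl T _ w); first by rewrite layer_emb_incl.
    rewrite -[LHS]/(layer_emb T (j + l + n).+1 (t (j + l).+1 (layer_incl T _ w))).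
    by rewrite -tS layer_emb_incl.
  move=> xy; have [w1 w1E <-] := up k m x; have [w2 w2E <-] := up m k y.
  have : layer_emb T (m + k + n) w1 = layer_emb T (k + m + n) w2 by rewrite w1E w2E.
  rewrite (addnC k m) in w2 w2E *; by move/fmorph_inj ->.
have cover (y : Finf T) : exists kx : {k : nat & layer T (k + n)}, layer_emb T _ (tagged kx) = y.
  have [m [x <-]] := layer_union y.
  have [z zE] := layer_emb_le x (leq_addr n m).
  by exists (Tagged (fun k => layer T (k + n)) z).
have cover2 (y z : Finf T) : exists k, exists x1 x2 : layer T (k + n),
    layer_emb T _ x1 = y /\ layer_emb T _ x2 = z.
  have [[k1 x1] /= <-] := cover y; have [[k2 x2] /= <-] := cover z.
  have [y1 y1E] := layer_emb_le x1 (leq_add (leq_addr k2 k1) (leqnn n)).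
  have [y2 y2E] := layer_emb_le x2 (leq_add (leq_addl k1 k2) (leqnn n)).
  by exists (k1 + k2)%N, y1, y2.
have /choice[c cE] := cover.
pose f y := layer_emb T _ (t (tag (c y)) (tagged (c y))).
have fE k x : f (layer_emb T (k + n) x) = layer_emb T _ (t k x) by apply: glue; rewrite cE.
have fB : zmod_morphism f.
  move=> y z; have [k [x1 [x2 [<- <-]]]] := cover2 y z.
  by rewrite -rmorphB !fE !rmorphB.
have fM : monoid_morphism f.
  split; first by rewrite -(rmorph1 (layer_emb T (0 + n))) fE !rmorph1.
  move=> y z; have [k [x1 [x2 [<- <-]]]] := cover2 y z.
  by rewrite -rmorphM !fE !rmorphM.
pose fR : {rmorphism Finf T -> Finf T} := HB.pack f
  (GRing.isZmodMorphism.Build _ _ f fB) (GRing.isMonoidMorphism.Build _ _ f fM).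
have emb_alg k (a : F) : layer_emb T k a%:A = layer_emb T 0%N a%:A.
  elim: k => // k <-; rewrite -[RHS]layer_emb_incl; congr (layer_emb T _ _).
  by rewrite linearZ /= rmorph1.
have f_bij : bijective fR.
  have f_surj y : exists x, f x = y.
    have [[k x] /= <-] := cover y.
    exists (layer_emb T (k + n) ((t k)^-1%g x)); rewrite fE; congr (layer_emb T _ _).
    by rewrite -galM ?memvf // mulVg gal_id.
  have /choice[g gE] := f_surj.
  by exists g => // x; apply: (fmorph_inj fR); apply: gE.
have f_fix (a : F) : fR (layer_emb T 0%N a%:A) = layer_emb T 0%N a%:A.
  by rewrite -(emb_alg (0 + n)%N) [LHS]fE; congr (layer_emb T _ _); apply: gal_alg.
by exists (GalInf f_bij f_fix) => x; exact: (fE 0%N).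
Qed.

End Automorphisms.

Section Tower.
Variables (p : nat) (F : fieldExtType rat) (T : Zp_extension p F) (gamma : Gal_inf T).
Hypotheses (p_pr : prime p) (top_gen : is_top_generator gamma).
Implicit Types y z : Finf T.

Definition in_layer n y := exists x : layer T n, layer_emb T n x = y.

Lemma in_layer_emb n (x : layer T n) : in_layer n (layer_emb T n x).
Proof. by exists x. Qed.

Lemma in_layer1 n : in_layer n 1.
Proof. by exists 1; rewrite rmorph1. Qed.

Lemma in_layerM n y z : in_layer n y -> in_layer n z -> in_layer n (y * z).
Proof. by move=> [x <-] [w <-]; exists (x * w); rewrite rmorphM. Qed.

Lemma in_layerV n y : in_layer n y -> in_layer n y^-1.
Proof. by move=> [x <-]; exists x^-1; rewrite fmorphV. Qed.

Lemma in_layerX n y k : in_layer n y -> in_layer n (y ^+ k).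
Proof. by move=> [x <-]; exists (x ^+ k); rewrite rmorphXn. Qed.

Lemma in_layer_le n m y : (n <= m)%N -> in_layer n y -> in_layer m y.
Proof. by move=> nm [x <-]; have [w] := layer_emb_le x nm; exists w. Qed.

Lemma in_layer_exists y : exists n, in_layer n y.
Proof. by have [n [x xE]] := layer_union y; exists n, x. Qed.

Local Notation g n := (gal_inf_restr gamma n).

Lemma iter_gamma_emb k n (x : layer T n) :
  iter k gamma (layer_emb T n x) = layer_emb T n ((g n ^+ k)%g x).
Proof.
elim: k x => [|k IH] x; first by rewrite expg0 gal_id.
by rewrite iterSr expgS galM ?memvf // -IH gal_inf_restrE.
Qed.

Lemma iter_gammaM k : {morph iter k gamma : y z / y * z}.
Proof. by move=> y z; elim: k => //= k ->; rewrite rmorphM. Qed.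

Lemma iter_gammaV k : {morph iter k gamma : y / y^-1}.
Proof. by move=> y; elim: k => //= k ->; rewrite fmorphV. Qed.

Lemma iter_gamma1 k : iter k gamma 1 = 1.
Proof. by elim: k => //= k ->; rewrite rmorph1. Qed.

Lemma iter_gammaX k m : {morph iter k gamma : y / y ^+ m}.
Proof. by move=> y; elim: k => //= k ->; rewrite rmorphXn. Qed.

Lemma in_layer_gamma k n y : in_layer n y -> in_layer n (iter k gamma y).
Proof. by move=> [x <-]; rewrite iter_gamma_emb; apply: in_layer_emb. Qed.

Lemma p_unit_gamma k y : is_p_unit p y -> is_p_unit p (iter k gamma y).
Proof. by move=> Uy; elim: k => //= k /(is_p_unit_rmorph p gamma _).2. Qed.

(** The density of the powers of gamma is a statement about automorphisms of the union; it
descends to layer n because the automorphisms of layer n lift. *)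
Lemma layer_gal_cycle n : 'Gal({:layer T n} / 1)%g = <[g n]>%g.
Proof.
apply/setP => s; rewrite mem_gal_full; apply/esym.
have [S SE] := layer_gal_lift s; have [k kE] := top_gen S n.
have -> : s = (g n ^+ k)%g.
  apply/eqP/gal_eqP => x _; apply: (fmorph_inj (layer_emb T n)).
  by rewrite -SE kE iter_gamma_emb.
exact: mem_cycle.
Qed.

Lemma order_gamma n : #[g n]%g = (p ^ n)%N.
Proof. by rewrite orderE -layer_gal_cycle card_gal_full layer_degree. Qed.

Lemma iter_gamma_fix n k y : in_layer n y -> iter (p ^ n * k) gamma y = y.
Proof.
move=> [x <-]; rewrite iter_gamma_emb; congr (layer_emb T _ _).
by rewrite -order_gamma expgM expg_order expg1n gal_id.
Qed.

Lemma gamma_fixed n y : in_layer n y -> gamma y = y -> in_layer 0 y.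
Proof.
move=> [x <-] gx; have : x \in fixedField 'Gal({:layer T n} / 1)%g.
  apply/fixedFieldP; first exact: memvf.
  rewrite layer_gal_cycle => _ /cycleP[k ->]; apply: (fmorph_inj (layer_emb T n)).
  by rewrite -iter_gamma_emb; elim: k => //= k ->.
rewrite (galois_fixedField (galois_full _)).
case/vlineP => a ->; elim: n {x gx} => [|n IH]; first exact: in_layer_emb.
rewrite (_ : a%:A = layer_incl T n a%:A) ?layer_emb_incl //.
by rewrite linearZ /= rmorph1.
Qed.

(** The norm from layer m to layer n, computed in the union of the layers. *)
Definition tnorm n m y := \prod_(j < p ^ (m - n)) iter (p ^ n * j) gamma y.

Lemma tnormM n m : {morph tnorm n m : y z / y * z}.
Proof. by move=> y z; rewrite -big_split; apply: eq_bigr => j _; apply: iter_gammaM. Qed.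

Lemma tnormV n m : {morph tnorm n m : y / y^-1}.
Proof. by move=> y; rewrite -prodfV; apply: eq_bigr => j _; apply: iter_gammaV. Qed.

Lemma tnorm1 n m : tnorm n m 1 = 1.
Proof. by apply: big1 => j _; apply: iter_gamma1. Qed.

Lemma tnormX n m k : {morph tnorm n m : y / y ^+ k}.
Proof. by move=> y; rewrite -prodrXl; apply: eq_bigr => j _; apply: iter_gammaX. Qed.

Lemma tnorm_gamma n m y : tnorm n m (gamma y) = gamma (tnorm n m y).
Proof. by rewrite rmorph_prod; apply: eq_bigr => j _; rewrite -iterS -iterSr. Qed.

Lemma tnorm_neq0 n m y : y != 0 -> tnorm n m y != 0.
Proof.
move=> y0; apply/prodf_neq0 => j _; elim: (_ * _)%N => //= k.
by rewrite fmorph_eq0.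
Qed.

Lemma tnorm_id n y : tnorm n n y = y.
Proof. by rewrite /tnorm subnn expn0 big_ord1 muln0. Qed.

Lemma tnorm_fix n m y : in_layer n y -> tnorm n m y = y ^+ (p ^ (m - n)).
Proof.
move=> yn; rewrite /tnorm (eq_bigr (fun=> y)) => [|j _]; last exact: iter_gamma_fix.
by rewrite prodr_const card_ord.
Qed.

Lemma big_ord_mul (R : comPzRingType) (a b : nat) (f : nat -> R) :
  \prod_(j < a * b) f j = \prod_(i < a) \prod_(l < b) f (i + a * l)%N.
Proof.
elim: b => [|b IH].
  by rewrite muln0 big_ord0 big1 // => i _; rewrite big_ord0.
rewrite mulnS addnC big_split_ord /= IH.
under [RHS]eq_bigr => i _ do rewrite big_ord_recr /=.
rewrite big_split /=; congr (_ * _).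
by apply: eq_bigr => i _; rewrite addnC.
Qed.

Lemma tnorm_trans n m l y : (n <= m)%N -> (m <= l)%N ->
  tnorm n m (tnorm m l y) = tnorm n l y.
Proof.
move=> nm ml; have E : (l - n = (m - n) + (l - m))%N by rewrite addnC addnBA // subnK.
rewrite /tnorm E expnD (big_ord_mul _ _ (fun j => iter (p ^ n * j) gamma y)).
apply: eq_bigr => i _; rewrite (big_morph _ (iter_gammaM _) (iter_gamma1 _)).
apply: eq_bigr => j _; rewrite -iterD mulnDr mulnA -expnD subnKC //.
Qed.

Lemma tnorm_step n (x : layer T n.+1) :
  tnorm n n.+1 (layer_emb T n.+1 x) = layer_emb T n (rel_norm (layer_incl T n) x).
Proof.
pose s := (g n.+1 ^+ (p ^ n))%g; pose i := layer_incl T n.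
have os : #[s]%g = p.
  rewrite orderXdiv order_gamma ?dvdn_exp2l // expnS mulnK // expn_gt0 prime_gt0 //.
have sG : 'Gal({:layer T n.+1} / limg i)%g = <[s]>%g.
  apply/esym/eqP; rewrite eqEcard cycle_subG -orderE os; apply/andP; split.
    rewrite gal_kHom ?subvf //; apply/kAHomP => _ /memv_imgP[w _ ->].
    apply: (fmorph_inj (layer_emb T n.+1)); apply: etrans (esym (iter_gamma_emb (p ^ n) (i w))) _.
    by rewrite layer_emb_incl -[(p ^ n)%N]muln1 iter_gamma_fix //; apply: in_layer_emb.
  rewrite -(galois_dim (galois_ahom i)) limg_dim_eq; last first.
    by apply/eqP; rewrite (eqP (AHom_lker0 i)) capv0.
  by rewrite !layer_degree expnS mulnK // expn_gt0 prime_gt0.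
rewrite -[RHS]layer_emb_incl; apply: (etrans _ (congr1 (layer_emb T n.+1) (esym (rel_normE (layer_incl T n) x)))).
rewrite (galNorm_cycle _ sG) os rmorph_prod.
rewrite /tnorm subSnn expn1; apply: eq_bigr => j _.
by rewrite iter_gamma_emb expgM.
Qed.
End Tower.

(** * Hilbert's Theorem 90 in the tower *)

Section TowerArithmetic.
Variables (p : nat) (F : fieldExtType rat) (T : Zp_extension p F) (gamma : Gal_inf T).
Hypotheses (p_pr : prime p) (top_gen : is_top_generator gamma).
Implicit Types y z : Finf T.

Lemma in_layer_tnorm n m y : (n <= m)%N -> in_layer m y -> in_layer n (tnorm gamma n m y).
Proof.
move=> /subnK <-; elim: (m - n)%N y => [|k IH] y yk; first by rewrite tnorm_id.
rewrite -(@tnorm_trans _ _ _ _ n (k + n)) ?leq_addl //; apply: IH.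
by move: yk => [x <-]; rewrite tnorm_step //; apply: in_layer_emb.
Qed.

Lemma p_unit_tnorm n m y : is_p_unit p y -> is_p_unit p (tnorm gamma n m y).
Proof.
move=> Uy; rewrite /tnorm; elim/big_rec: _ => [|j z _ Uz]; first exact: is_p_unit1.
by apply: is_p_unitM => //; apply: p_unit_gamma.
Qed.

Lemma tnorm_Hilbert90 n y : in_layer n y -> tnorm gamma 0 n y = 1 ->
  exists v, [/\ in_layer n v, v != 0 & y = gamma v / v].
Proof.
move=> [x <-] Nx.
have gen : generator 'Gal({:layer T n} / 1) (gal_inf_restr gamma n).
  by rewrite /generator -layer_gal_cycle.
have /(Hilbert's_theorem_90 gen (memvf x))[b [_ b0] xE] : galNorm 1 {:layer T n} x == 1.
  apply/eqP/(fmorph_inj (layer_emb T n)); rewrite rmorph1 -[RHS]Nx.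
  rewrite (galNorm_cycle _ (layer_gal_cycle top_gen n)) order_gamma // rmorph_prod.
  rewrite /tnorm subn0; apply: eq_bigr => j _.
  by rewrite iter_gamma_emb expn0 mul1n.
exists (layer_emb T n b^-1); split; first exact: in_layer_emb.
  by rewrite fmorph_eq0 invr_eq0.
by rewrite xE rmorphM !fmorphV invrK gal_inf_restrE mulrC.
Qed.

(** From some layer on, no new roots of unity of order dividing p ^ s appear, so
norms between such layers raise them to p-powers. *)
Lemma torsion_norm n s : exists2 m, (n <= m)%N &
  forall y, in_layer m y -> y ^+ (p ^ s) = 1 -> tnorm gamma n m y = 1.
Proof.
pose P t := `[< exists z : Finf T, (p ^ t)%N.-primitive_root z >] && (t <= s)%N.
have exP : exists t, P t.
  exists 0%N; rewrite /P leq0n andbT; apply/asboolP; exists 1.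
  by apply/andP; split=> //; apply/forallP => i; rewrite [i]ord1 unity_rootE expr1 !eqxx.
have boundP t : P t -> (t <= s)%N by case/andP.
have [t /andP[/asboolP[z prim_z] ts] tmax] := ex_maxnP exP boundP.
have [n0 zn0] := in_layer_exists z.
exists (maxn n n0 + s)%N; first by rewrite (leq_trans (leq_maxl n n0)) ?leq_addr.
move=> y ym ys.
have [|l prim_y /(dvdn_pfactor _ _ p_pr)[r rs lE]] := prim_order_exists _ ys.
  by rewrite expn_gt0 prime_gt0.
have yt : y ^+ (p ^ t) = 1.
  have /subnK <- : (r <= t)%N.
    by apply: tmax; rewrite /P rs andbT; apply/asboolP; exists y; rewrite -lE.
  by rewrite addnC expnD exprM -lE (prim_expr_order prim_y) expr1n.
have [i yE] := prim_rootP prim_z yt.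
have yn0 : in_layer (maxn n n0) y.
  by rewrite yE; apply/in_layerX/(in_layer_le _ zn0); rewrite leq_maxr.
rewrite -(@tnorm_trans _ _ _ _ n (maxn n n0)) ?leq_maxl ?leq_addr //.
rewrite (tnorm_fix top_gen (n := maxn n n0)) // addKn ys.
exact: tnorm1.
Qed.

(** If gamma fixes y modulo p ^ j-th powers, Hilbert's Theorem 90 writes a bounded power
y ^ (p ^ s) as f * w ^ (p ^ j) with f in the bottom layer. Norms raise f to large p-powers,
so the norm of y is a p-power up to a root of unity, which disappears in the norm to
a lower layer. Here p ^ s kills the p-power roots of unity of the bottom layer, one of
which is the norm of x. *)
Lemma tnorm_invariant n m : exists2 B, (n <= B)%N & forall j y x, (B <= j)%N ->
  in_layer j y -> in_layer j x -> y != 0 -> gamma y = y * x ^+ (p ^ j) ->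
  exists2 z, in_layer n z & tnorm gamma n j y = z ^+ (p ^ m).
Proof.
have [s sP] := @p_torsion_exponent (baseFieldType (layer T 0)) p p_pr.
have {}sP k z : in_layer 0 z -> z ^+ (p ^ k) = 1 -> z ^+ (p ^ s) = 1.
  move=> [w <-]; rewrite -!rmorphXn => /eqP; rewrite fmorph_eq1 => /eqP wk.
  by rewrite (sP k w wk) rmorph1.
have [m1 nm1 tors] := torsion_norm n s.
exists (m1 + (m + s))%N => [|j y x Bj yj xj y0 gy]; first exact: leq_trans nm1 (leq_addr _ _).
have m1j : (m1 <= j)%N := leq_trans (leq_addr _ _) Bj.
have x0 : x != 0.
  have : gamma y != 0 by rewrite fmorph_eq0.
  by rewrite gy mulf_eq0 negb_or => /andP[_]; rewrite expf_eq0 expn_gt0 prime_gt0.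
have Nx : tnorm gamma 0 j (x ^+ (p ^ s)) = 1.
  rewrite tnormX; apply: (sP j); first exact: in_layer_tnorm.
  have := congr1 (tnorm gamma 0 j) gy; rewrite tnormM tnormX tnorm_gamma.
  have := iter_gamma_fix top_gen 1 (in_layer_tnorm (leq0n j) yj).
  rewrite expn0 mul1n /= => ->; rewrite -[X in X = _ -> _]mulr1.
  by move/(mulfI (tnorm_neq0 _ _ _ y0)).
have [w [wj w0 xw]] := tnorm_Hilbert90 (in_layerX _ xj) Nx.
pose f := y ^+ (p ^ s) / w ^+ (p ^ j).
have f0 : in_layer 0 f.
  apply: (gamma_fixed top_gen (n := j)).
    by apply: in_layerM; [apply: in_layerX | apply/in_layerV/in_layerX].
  rewrite /f rmorphM fmorphV !rmorphXn gy.
  have -> : gamma w = w * x ^+ (p ^ s) by rewrite xw mulrC divfK.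
  rewrite !exprMn -!exprM mulnC invfM mulrACA mulfV ?mulr1 //.
  by rewrite expf_neq0.
have ysE : y ^+ (p ^ s) = f * w ^+ (p ^ j) by rewrite /f divfK // expf_neq0.
clearbody f.
pose w1 := tnorm gamma m1 j w.
have w1m : in_layer m1 w1 by apply: in_layer_tnorm.
pose z1 := f ^+ (p ^ (j - m1 - (m + s))) * w1 ^+ (p ^ (j - (m + s))).
have z1m : in_layer m1 z1.
  by apply: in_layerM; apply: in_layerX => //; apply: in_layer_le f0.
have y1E : tnorm gamma m1 j y ^+ (p ^ s) = (z1 ^+ (p ^ m)) ^+ (p ^ s).
  rewrite -tnormX ysE tnormM tnormX (tnorm_fix top_gen (n := m1)); last exact: in_layer_le f0.
  rewrite -[RHS]exprM -expnD /z1 exprMn -!exprM -!expnD [in RHS]subnK ?[in RHS]subnK //.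
    exact: leq_trans (leq_addl _ _) Bj.
  by rewrite leq_subRL.
have y1m : in_layer m1 (tnorm gamma m1 j y) by apply: in_layer_tnorm.
have y10 : tnorm gamma m1 j y != 0 by apply: tnorm_neq0.
have z10 : z1 ^+ (p ^ m) != 0.
  have : tnorm gamma m1 j y ^+ (p ^ s) != 0 by rewrite expf_neq0.
  by rewrite y1E expf_eq0 expn_gt0 prime_gt0.
exists (tnorm gamma n m1 z1); first exact: in_layer_tnorm.
rewrite -(@tnorm_trans _ _ _ _ n m1) // -tnormX -[tnorm gamma m1 j y](divfK z10).
rewrite tnormM tors ?mul1r //.
  by apply: in_layerM => //; apply/in_layerV/in_layerX.
by rewrite expr_div_n y1E divff // expf_neq0.
Qed.

End TowerArithmetic.

Section Coboundary.
Variables (p : nat) (F : fieldExtType rat) (T : Zp_extension p F) (gamma : Gal_inf T).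
Hypotheses (p_pr : prime p) (cyclo : is_cyclotomic T) (top_gen : is_top_generator gamma).
Implicit Types y z : Finf T.

Lemma layer_incl_le n m : (n <= m)%N ->
  exists i : 'AHom(layer T n, layer T m), forall x, layer_emb T m (i x) = layer_emb T n x.
Proof.
move=> /subnK <-; elim: (m - n)%N => [|k [i iE]].
  by exists \1%AF => x; rewrite id_lfunE.
exists (layer_incl T (k + n) \o i)%AF => x.
by rewrite comp_lfunE layer_emb_incl.
Qed.

(** The ideal (W) outside p is the N-th power of the ideal of e in a higher layer, hence
of an ideal of layer n itself, since the layers are unramified outside p. A bounded
power of the latter is principal. *)
Lemma norm_class_group n : exists2 h : nat, (0 < h)%N &
  forall (N j : nat) W e u, (0 < N)%N -> (n <= j)%N -> in_layer n W -> in_layer j e ->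
    in_layer j u -> W != 0 -> W = e ^+ N * u -> is_p_unit p u ->
  exists k z, [/\ (0 < k)%N, (k <= h)%N, in_layer n z, z != 0 & is_p_unit p (W ^+ k / z ^+ N)].
Proof.
have [h h0 hP] := class_group_exponent (baseFieldType (layer T n)).
exists h => // N j _ _ _ N0 nj [W <-] [e <-] [u <-] W0 WE Uu.
have [r [E [zE [hE [prim_zE zE_lim]]]]] := cyclo j.
have [L [z [hL [prim_z gen_z]]]] := cyclotomic_splitting_field prim_zE zE_lim.
have [i0 i0E] := layer_incl_le nj.
pose i : 'AHom(layer T n, L) := (hL \o i0)%AF.
have iE x : i x = hL (i0 x) by rewrite comp_lfunE.
have {}W0 : W != 0 by move: W0; rewrite fmorph_eq0.
have aE : i W = hL e ^+ N * hL u.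
  rewrite iE -rmorphXn -rmorphM; congr (hL _).
  by apply: (fmorph_inj (layer_emb T j)); rewrite i0E WE rmorphM rmorphXn.
have Uhu : is_p_unit p (hL u).
  apply: (is_p_unit_rmorph p hL u).2; exact: (is_p_unit_rmorph p (layer_emb T j) u).1.
have [k [w [k0 kh w0 wP]]] := hP N W N0 W0.
exists k, (layer_emb T n w); split=> //; [exact: in_layer_emb | by rewrite fmorph_eq0 |].
rewrite -!rmorphXn -fmorphV -rmorphM; apply: (is_p_unit_rmorph p (layer_emb T n) _).2.
apply: (is_p_unit_rmorph p i _).1; apply/p_unit_vunit.
split; first by rewrite fmorph_eq0 mulf_neq0 ?invr_eq0 ?expf_neq0.
move=> V valV Vp.
have [f f0 [iWf0 VWf VWfi]] := unramified_root prim_z gen_z N0 W0 aE Uhu valV Vp.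
have [|c0 Vc Vci] := wP _ f (valring_comap i valV) f0.
  split=> //; last by rewrite /= fmorphV.
  by move: iWf0; rewrite fmorph_eq0.
by split=> //; [rewrite fmorph_eq0 | rewrite -fmorphV].
Qed.

(** If u has norm a ^ (p ^ M) in the bottom layer, then u / a ^ (p ^ (M - j)) has norm 1
and is gamma v / v by Hilbert's Theorem 90. The conjugates of v differ from v by a p-unit times
a p-power, so the norm W of v to layer n, a product of many conjugates, is a p-unit
times a p-power in layer j. By the finiteness of the class group it is so in layer n too,
and the p-power may be ignored. *)
Lemma norm_coboundary n m : exists j M, [/\ (n <= j)%N, (m <= M)%N &
  forall u a, in_layer j u -> is_p_unit p u -> in_layer 0 a ->
    tnorm gamma 0 j u = a ^+ (p ^ M) ->
  exists w z, [/\ in_layer n w, is_p_unit p w, in_layer n z &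
    tnorm gamma n j u = gamma w / w * z ^+ (p ^ m)]].
Proof.
have [h h0 classP] := norm_class_group n.
pose m2 := (m + h)%N; pose j := (n + m2)%N; pose M := (m2 + j)%N.
exists j, M; split=> [||u a uj Uu a0l Nu]; first exact: leq_addr.
  by rewrite /M /m2 -!addnA leq_addr.
have nj : (n <= j)%N by apply: leq_addr.
have u0 : u != 0 by case: Uu.
have a0 : a != 0.
  have := tnorm_neq0 gamma 0 j u0; rewrite Nu expf_eq0 expn_gt0 prime_gt0 //.
have aj : in_layer j a by apply: in_layer_le a0l.
have [||v [vj v0 uE]] := tnorm_Hilbert90 top_gen (n := j) (y := u / a ^+ (p ^ m2)).
- by apply: in_layerM => //; apply/in_layerV/in_layerX.
- rewrite tnormM tnormV tnormX Nu (tnorm_fix top_gen (n := 0)) // subn0 -exprM -expnD addnC.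
  by rewrite divff // expf_neq0.
have gv : gamma v = v * (u * a^-1 ^+ (p ^ m2)) by rewrite exprVn uE mulrC divfK.
pose Q k y := exists c e, [/\ in_layer j c, in_layer j e, is_p_unit p e &
  y = v ^+ k * c ^+ (p ^ m2) * e].
have Qiter k : Q 1%N (iter k gamma v).
  elim: k => [|k [c [e [cj ej Ue yE]]]].
    exists 1, 1; split; [exact: in_layer1 | exact: in_layer1 | exact: is_p_unit1 |].
    by rewrite expr1n !mulr1.
  exists (a^-1 * gamma c), (u * gamma e); split.
  - by apply: in_layerM; [exact: in_layerV | exact: (in_layer_gamma gamma 1)].
  - by apply: in_layerM => //; exact: (in_layer_gamma gamma 1).
  - by apply: is_p_unitM => //; exact: (p_unit_gamma gamma 1).
  by rewrite /= yE !rmorphM !rmorphXn gv expr1 exprMn; ring.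
have Qprod K (f : nat -> nat) : Q K (\prod_(i < K) iter (f i) gamma v).
  elim: K => [|K [c [e [cj ej Ue yE]]]].
    exists 1, 1; rewrite big_ord0 expr0 expr1n !mulr1.
    by split; [exact: in_layer1 | exact: in_layer1 | exact: is_p_unit1 |].
  have [c' [e' [c'j e'j Ue' y'E]]] := Qiter (f K).
  exists (c * c'), (e * e'); split; [exact: in_layerM | exact: in_layerM | exact: is_p_unitM |].
  by rewrite big_ord_recr /= yE y'E exprMn -[K.+1]addn1 exprD; ring.
pose W := tnorm gamma n j v.
have Wn : in_layer n W by apply: in_layer_tnorm.
have W0 : W != 0 by apply: tnorm_neq0.
have [c [e [cj ej Ue WE]]] : Q (p ^ (j - n))%N W by apply: Qprod.
have {}WE : W = (v * c) ^+ (p ^ m2) * e by rewrite WE addKn exprMn.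
have q0 k : (0 < p ^ k)%N by rewrite expn_gt0 prime_gt0.
have [k [z [k0 kh zn z0 Uz]]] := classP _ j W _ e (q0 m2) nj Wn (in_layerM vj cj) ej W0 WE Ue.
have [d cop_d kE] := pfactor_coprime p_pr k0; set l := logn p k in kE.
have lh : (l <= h)%N.
  apply: leq_trans kh; apply: leq_trans (ltnW (ltn_expl l (prime_gt1 p_pr))) _.
  by apply: dvdn_leq => //; rewrite kE dvdn_mull.
have lm2 : (l + (m2 - l) = m2)%N by rewrite subnKC // (leq_trans lh) ?leq_addl.
pose z1 := z ^+ (p ^ (m2 - l - m)).
have z1E : z1 ^+ (p ^ m) = z ^+ (p ^ (m2 - l)).
  by rewrite -exprM -expnD subnK // leq_subRL ?(leq_trans lh) ?leq_addl // addnC leq_add2l.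
pose e1 := W ^+ d / z1 ^+ (p ^ m).
have Ue1 : is_p_unit p e1.
  apply: (p_unit_root (q0 l)); rewrite /e1 z1E expr_div_n -!exprM -kE -expnD.
  by rewrite addnC lm2.
have z10 : z1 != 0 by apply: expf_neq0.
have d0 : (0 < d)%N.
  by rewrite lt0n; apply: contraTneq k0 => d0; rewrite kE d0 mul0n.
case: (egcdnP (p ^ m) d0) => al be.
have -> : gcdn d (p ^ m) = 1%N by apply/eqP; rewrite -/(coprime d (p ^ m)) coprime_sym coprimeXl.
move=> albe _; pose t := z1 ^+ al / W ^+ be.
have e1n : in_layer n e1.
  by apply: in_layerM; [|apply: in_layerV; do 2!apply: in_layerX]; try apply: in_layerX.
have WdE : W ^+ d = e1 * z1 ^+ (p ^ m) by rewrite /e1 divfK ?expf_neq0.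
clearbody e1.
have tn : in_layer n t.
  by apply: in_layerM; [do 2!apply: in_layerX | apply/in_layerV/in_layerX].
have WE' : W = e1 ^+ al * t ^+ (p ^ m).
  have -> : W = W ^+ (al * d) / W ^+ (be * p ^ m).
    by rewrite albe exprD expr1 mulrC mulKf // expf_neq0.
  by rewrite mulnC exprM WdE /t expr_div_n exprMn -!exprM mulrA [(al * _)%N]mulnC.
clearbody t; have aNn : in_layer n (tnorm gamma n j a) by apply: in_layer_tnorm.
exists (e1 ^+ al), (gamma t / t * tnorm gamma n j a ^+ (p ^ h)); split.
- exact: in_layerX.
- exact: is_p_unitX.
- by do ![apply: in_layerM]; rewrite ?(in_layerX _ aNn) //; [exact: (in_layer_gamma gamma 1) | exact: in_layerV | exact: in_layerX].
have -> : u = gamma v / v * a ^+ (p ^ m2) by rewrite -uE divfK // expf_neq0.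
have NE : tnorm gamma n j a ^+ (p ^ m2) = (tnorm gamma n j a ^+ (p ^ h)) ^+ (p ^ m).
  by rewrite -exprM -expnD addnC.
rewrite tnormM tnormM tnormV tnormX tnorm_gamma NE -/W WE'.
move: (e1 ^+ al) (_ ^+ (p ^ h)) => w b.
by rewrite rmorphM rmorphXn invfM !exprMn exprVn; ring.
Qed.

End Coboundary.

(** * The inverse limit *)

Section Limit.
Variables (p : nat) (F : fieldExtType rat) (T : Zp_extension p F) (gamma : Gal_inf T).
Hypotheses (p_pr : prime p) (top_gen : is_top_generator gamma).
Implicit Types y z : Finf T.
Local Open Scope quotient_scope.

Lemma p_unit_val_muln (K : fieldType) (x : p_units p K) k :
  p_unit_val (x *+ k) = p_unit_val x ^+ k.
Proof. by elim: k => [|k IH]; rewrite ?expr0 // mulrS exprS -IH. Qed.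

Lemma pi_modpow_eq0 (A : zmodType) m (x : A) :
  \pi_(modpow p A m) x = 0 <-> exists w, x = w *+ p ^ m.
Proof.
rewrite -(raddf0 \pi_(modpow p A m)); split=> [/eqP|[w ->]].
  by rewrite -Quotient.idealrBE subr0 => /asboolP.
by apply/eqP; rewrite -Quotient.idealrBE subr0; apply/asboolP; exists w.
Qed.

(** Representatives are taken in the union of the layers, so that all levels n and m can be
compared in one field. *)
Definition represents (u : barU'_inf T) n m y : Prop :=
  exists x : U' T n, layer_emb T n (p_unit_val x) = y /\
    \pi_(modpow p (U' T n) m) x = (u n : barU' T n) m.

Lemma represents_exists u n m : exists y, represents u n m y.
Proof.
pose x : U' T n := generic_quotient.repr ((u n : barU' T n) m).
by exists (layer_emb T n (p_unit_val x)), x; split=> //; apply: reprK.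
Qed.

Lemma represents_in_layer u n m y : represents u n m y -> in_layer n y.
Proof. by move=> [x [<- _]]; apply: in_layer_emb. Qed.

Lemma represents_p_unit u n m y : represents u n m y -> is_p_unit p y.
Proof. by move=> [x [<- _]]; apply: (is_p_unit_rmorph p _ _).2; apply: p_unitP. Qed.

Lemma p_unit_in_layer n y : in_layer n y -> is_p_unit p y ->
  exists x : U' T n, layer_emb T n (p_unit_val x) = y.
Proof. by move=> [x <-] /(is_p_unit_rmorph p _ _).1 Ux; exists (mk_p_unit Ux). Qed.

Lemma represents_mul u n m y z : represents u n m y -> in_layer n z -> is_p_unit p z ->
  represents u n m (y * z ^+ (p ^ m)).
Proof.
move=> [x [<- xE]] zn Uz; have [w <-] := p_unit_in_layer zn Uz.
exists (x + w *+ (p ^ m)); split; first by rewrite p_unitsDE p_unit_val_muln rmorphM rmorphXn.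
by rewrite raddfD /= xE (pi_modpow_eq0 _ _).2 ?addr0 //; exists w.
Qed.

Lemma represents_eq u n m y y' : represents u n m y -> represents u n m y' ->
  exists z, [/\ in_layer n z, is_p_unit p z & y = y' * z ^+ (p ^ m)].
Proof.
move=> [x [<- xE]] [x' [<- x'E]].
have /pi_modpow_eq0[w wE] : \pi_(modpow p (U' T n) m) (x - x') = 0.
  by rewrite raddfB /= xE x'E subrr.
exists (layer_emb T n (p_unit_val w)); split; first exact: in_layer_emb.
  by apply: (is_p_unit_rmorph p _ _).2; apply: p_unitP.
by rewrite -rmorphXn -rmorphM -p_unit_val_muln -wE -p_unitsDE addrC subrK.
Qed.

Lemma represents_ext u u' :
  (forall n m, exists y, represents u n m y /\ represents u' n m y) -> u = u'.
Proof.
move=> H; apply: plim_inj => n; apply: plim_inj => m.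
have [y [[x [<- <-]] [x' [xx' <-]]]] := H n m.
by congr (\pi_ _ _); apply/val_inj; apply: (fmorph_inj (layer_emb T n)).
Qed.

Lemma represents_le u n m m' y : (m <= m')%N -> represents u n m' y -> represents u n m y.
Proof.
move=> /subnK <-; elim: (m' - m)%N => // k IH [x [yE xE]]; apply: IH; exists x; split=> //.
rewrite -(plimP (u n : barU' T n) (k + m)).
exact: etrans (esym (@modpow_trans_pi p (U' T n) (k + m) x)) (congr1 (modpow_trans p (U' T n) (k + m)) xE).
Qed.

Lemma represents_norm1 u n m y : represents u n.+1 m y ->
  represents u n m (tnorm gamma n n.+1 y).
Proof.
move=> [x [<- xE]]; exists (p_units_norm (layer_incl T n) p x).
split; first by rewrite tnorm_step.
by rewrite -(plimP u n) /= -xE modpow_mapE.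
Qed.

Lemma represents_norm u n j m y : (n <= j)%N -> represents u j m y ->
  represents u n m (tnorm gamma n j y).
Proof.
move=> /subnK <-; elim: (j - n)%N y => [|k IH] y uy; first by rewrite tnorm_id.
rewrite -(@tnorm_trans _ _ _ _ n (k + n)) ?leq_addl //.
by apply: IH; apply: represents_norm1.
Qed.

Lemma represents_gamma u n m y : represents u n m y ->
  represents ((Lambda_elt gamma - 1) *: u) n m (gamma y / y).
Proof.
move=> [x [<- xE]]; exists (p_units_map p (gal_repr (gal_inf_restr gamma n)) x - x).
split; first by rewrite p_unitsDE p_unitsNE rmorphM fmorphV /= gal_inf_restrE.
have -> : (Lambda_elt gamma - 1) *: u = Lambda_elt gamma *: u - u.
  by rewrite scalerBl scale1r.
rewrite raddfB; congr (_ - _); last exact: xE.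
apply: etrans (esym (congr1 (fun v : barU' T n => v m) (barU'_inf_scale_elt gamma u n))).
by rewrite /= -xE modpow_mapE.
Qed.

Lemma represents_family (Y : nat -> nat -> Finf T) :
  (forall n m, in_layer n (Y n m) /\ is_p_unit p (Y n m)) ->
  (forall n m, exists2 z, in_layer n z & Y n m.+1 = Y n m * z ^+ (p ^ m)) ->
  (forall n m, exists2 z, in_layer n z & tnorm gamma n n.+1 (Y n.+1 m) = Y n m * z ^+ (p ^ m)) ->
  exists u, forall n m, represents u n m (Y n m).
Proof.
move=> YU Ytrans Ynorm.
have Yx n m : exists x : U' T n, layer_emb T n (p_unit_val x) = Y n m.
  by have [yn Uy] := YU n m; apply: p_unit_in_layer.
pose x n m : U' T n := sval (cid (Yx n m)).
have xE n m : layer_emb T n (p_unit_val (x n m)) = Y n m := svalP (cid (Yx n m)).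
have pi_eq n m (a b : U' T n) z : in_layer n z ->
    layer_emb T n (p_unit_val a) = layer_emb T n (p_unit_val b) * z ^+ (p ^ m) ->
    \pi_(modpow p (U' T n) m) a = \pi_(modpow p (U' T n) m) b.
  move=> zn abE.
  have b0 : layer_emb T n (p_unit_val b) != 0 by rewrite fmorph_eq0; case: (p_unitP b).
  have zE : z ^+ (p ^ m) = layer_emb T n (p_unit_val (a - b)).
    by rewrite p_unitsDE p_unitsNE rmorphM fmorphV abE mulrAC divff // mul1r.
  have Uz : is_p_unit p z.
    apply: (@p_unit_root _ _ _ (p ^ m)); first by rewrite expn_gt0 prime_gt0.
    by rewrite zE; apply: (is_p_unit_rmorph p _ _).2; apply: p_unitP.
  have [w wE] := p_unit_in_layer zn Uz.
  apply/eqP; rewrite -subr_eq0 -raddfB; apply/eqP/pi_modpow_eq0; exists w.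
  apply/val_inj/(fmorph_inj (layer_emb T n)).
  by apply: etrans (esym zE) _; rewrite -wE -rmorphXn -p_unit_val_muln.
pose xbar n m := \pi_(modpow p (U' T n) m) (x n m).
have xtrans n m : modpow_trans p (U' T n) m (xbar n m.+1) = xbar n m.
  rewrite modpow_trans_pi; have [z zn zE] := Ytrans n m.
  by apply: (pi_eq n m _ _ z) => //; rewrite !xE.
pose un n : barU' T n := PLim (A := fun m => modpow p (U' T n) m)
  (f := fun m => modpow_trans p (U' T n) m) (xtrans n).
have unorm n : norm_barU' T n (un n.+1) = un n.
  apply: plim_inj => m /=; rewrite modpow_mapE //; have [z zn zE] := Ynorm n m.
  by apply: (pi_eq n m _ _ z) => //; apply: etrans (esym (tnorm_step p_pr top_gen _)) _; rewrite !xE.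
by exists (PLim (A := barU' T) (f := norm_barU' T) unorm) => n m; exists (x n m).
Qed.

End Limit.

Section Commutative.
Variables (p : nat) (F : fieldExtType rat) (T : Zp_extension p F).

Lemma gr_mulC n : commutative (@gr_mul (padic_int p) (layer_gal T n)).
Proof.
move=> f h; apply/ffunP => x; rewrite !ffunE.
rewrite (reindex_inj (h := fun y => (x * y^-1)%g)) /=; last first.
  by move=> y z /mulgI/invg_inj.
apply: eq_bigr => y _; rewrite mulrC; congr (h _ * f _).
  by rewrite invMg invgK mulgKV.
exact: layer_gal_abelian.
Qed.

Lemma Lambda_mulC : commutative (@Lambda_mul p F T).
Proof. by move=> a b; apply: plim_inj => n; apply: gr_mulC. Qed.

End Commutative.

Section Surjectivity.
Variables (p : nat) (F : fieldExtType rat) (T : Zp_extension p F) (gamma : Gal_inf T).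
Hypotheses (p_pr : prime p) (cyclo : is_cyclotomic T) (top_gen : is_top_generator gamma).
Implicit Types (y z : Finf T) (u : barU'_inf T).
Local Notation delta := (Lambda_elt gamma - 1).

Lemma represents_zero n m z : in_layer n z -> is_p_unit p z ->
  represents (0 : barU'_inf T) n m (z ^+ (p ^ m)).
Proof.
move=> zn Uz; rewrite -[z ^+ _]mul1r; apply: represents_mul => //.
exists 0; split; first by rewrite p_units0E rmorph1.
exact: raddf0.
Qed.

Lemma represents_zero_power n m y : represents (0 : barU'_inf T) n m y ->
  exists z, [/\ in_layer n z, is_p_unit p z & y = z ^+ (p ^ m)].
Proof.
move=> y0; have [z [zn Uz yE]] := represents_eq y0
   (represents_zero m (in_layer1 T n) (is_p_unit1 p _)).
by exists z; rewrite yE expr1n mul1r.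
Qed.

Lemma delta_bottom u : (delta *: u) 0%N = 0 :> barU' T 0.
Proof.
have -> : 0 = (0 : barU'_inf T) 0%N by [].
apply: plim_inj => m; have [y uy] := represents_exists u 0 m.
have [[x [xE <-]] [x' [x'E <-]]] :
    represents (delta *: u) 0 m 1 /\ represents (0 : barU'_inf T) 0 m 1.
  split; last by rewrite -(expr1n _ (p ^ m)); apply: represents_zero;
    [exact: in_layer1 | exact: is_p_unit1].
  have yl := represents_in_layer uy; have [y0 _] := represents_p_unit uy.
  have := represents_gamma gamma uy; have := iter_gamma_fix top_gen 1 yl.
  by rewrite expn0 muln1 /= => ->; rewrite divff.
congr (\pi_ _ _)%qT; apply/val_inj/(fmorph_inj (layer_emb T 0)).
exact: etrans xE (esym x'E).
Qed.

(** The components of an invariant u are norms of invariant classes from all higher layers, so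
they are arbitrarily divisible by p. *)
Lemma delta_inj u : delta *: u = 0 -> u = 0.
Proof.
move=> du; apply: (represents_ext (T := T)) => n m.
have [B nB BP] := tnorm_invariant p_pr top_gen n m.
pose j := maxn B m; have [y uy] := represents_exists u j j.
have nj : (n <= j)%N by rewrite (leq_trans nB) ?leq_maxl.
have [y0 _] := represents_p_unit uy.
have := represents_gamma gamma uy; rewrite du => /represents_zero_power[x [xj Ux gyE]].
have [|z zn zE] := BP j y x (leq_maxl _ _) (represents_in_layer uy) xj y0.
  by rewrite -gyE mulrC divfK.
have ry := represents_norm p_pr top_gen nj (represents_le (leq_maxr B m) uy).
exists (z ^+ (p ^ m)); split; first by rewrite -zE.
apply: represents_zero => //; apply: (@p_unit_root _ _ _ (p ^ m)).
  by rewrite expn_gt0 prime_gt0.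
by rewrite -zE; apply: represents_p_unit ry.
Qed.

(** As u_0 = 0, a representative of u in a high layer has a p-power as its norm to the bottom
layer. *)
Lemma delta_solution u j : u 0%N = 0 ->
  exists w, [/\ in_layer j w, is_p_unit p w & represents u j j (gamma w / w)].
Proof.
move=> u0; have [j' [M [jj' jM cob]]] := norm_coboundary p_pr cyclo top_gen j j.
have [y uy] := represents_exists u j' M.
have N0 := represents_norm p_pr top_gen (leq0n j') uy.
have [a [a0 Ua NE]] : exists a, [/\ in_layer 0 a, is_p_unit p a &
    tnorm gamma 0 j' y = a ^+ (p ^ M)].
  apply: (@represents_zero_power 0 M); have [x [xE xu]] := N0.
  by exists x; split=> //; rewrite xu u0.
have [w [z [wj Uw zj NyE]]] := cob y a (represents_in_layer uy) (represents_p_unit uy) a0 NE.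
exists w; split=> //.
have ry := represents_le jM (represents_norm p_pr top_gen jj' uy).
have Uq : is_p_unit p (gamma w / w).
  by apply: is_p_unitM; [exact: (p_unit_gamma gamma 1) | exact: is_p_unitV].
have Uz : is_p_unit p z.
  apply: (@p_unit_root _ _ _ (p ^ j)); first by rewrite expn_gt0 prime_gt0.
  have [q0 _] := Uq; have -> : z ^+ (p ^ j) = tnorm gamma j j' y * (gamma w / w)^-1.
    by rewrite NyE mulrC mulKf.
  by apply: is_p_unitM; [exact: represents_p_unit ry | exact: is_p_unitV].
have := represents_mul ry (in_layerV zj) (is_p_unitV Uz).
by rewrite NyE exprVn mulfK //; have [z0 _] := Uz; rewrite expf_neq0.
Qed.

(** Let w_j be a solution of (gamma - 1) w = u in layer j modulo p ^ j. Two solutions at the same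
level differ by a class fixed by gamma, whose norm to a given layer n is a p ^ m-th
power once j is large. So, modulo p ^ m, the norms of the w_j to layer n are eventually
constant in j. *)
Lemma delta_surj u : u 0%N = 0 -> exists v, delta *: v = u.
Proof.
move=> u0; have [w wP] := choice (fun j => delta_solution j u0).
have invB (nm : nat * nat) : exists B, (nm.1 <= B)%N /\ forall j y x, (B <= j)%N ->
    in_layer j y -> in_layer j x -> y != 0 -> gamma y = y * x ^+ (p ^ j) ->
    exists2 z, in_layer nm.1 z & tnorm gamma nm.1 j y = z ^+ (p ^ nm.2).
  by have [B nB BP] := tnorm_invariant p_pr top_gen nm.1 nm.2; exists B.
have [B BP] := choice invB.
(* Y n m is the stable value in layer n modulo p ^ m *)
pose J n m := maxn (B (n, m)) m; pose Y n m := tnorm gamma n (J n m) (w (J n m)).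
have nJ n m : (n <= J n m)%N.
  by have [nB _] := BP (n, m); apply: leq_trans nB (leq_maxl _ _).
have p0 k : (0 < p ^ k)%N by rewrite expn_gt0 prime_gt0.
have stable n m j : (J n m <= j)%N ->
    exists2 z, in_layer n z & tnorm gamma n j (w j) = Y n m * z ^+ (p ^ m).
  move=> Jj; set j0 := J n m in Jj *.
  have [wj Uwj rwj] := wP j; have [wj0 Uwj0 rwj0] := wP j0.
  pose w' := tnorm gamma j0 j (w j).
  have w'j0 : in_layer j0 w' by apply: in_layer_tnorm.
  have [w0 _] := Uwj0; have w'0 : w' != 0 by apply: tnorm_neq0; have [] := Uwj.
  have rw' : represents u j0 j0 (gamma w' / w').
    rewrite -tnorm_gamma -tnormV -tnormM; apply: represents_norm => //.
    exact: represents_le rwj.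
  have [x [xj0 Ux xE]] := represents_eq rw' rwj0.
  have [_ BPnm] := BP (n, m).
  have [|||z zn zE] := BPnm j0 (w' / w j0) x (leq_maxl _ _) _ xj0.
  - by apply: in_layerM => //; apply: in_layerV.
  - by rewrite mulf_neq0 ?invr_eq0.
  - rewrite rmorphM fmorphV; have gw0 : gamma (w j0) != 0 by rewrite fmorph_eq0.
    have -> : gamma w' = w' * (gamma (w j0) / w j0 * x ^+ (p ^ j0)).
      by rewrite -xE mulrC divfK.
    by rewrite mulrAC -!mulrA; congr (w' * _); rewrite mulrCA !mulrA mulfV // mul1r mulrC.
  exists z => //; rewrite -(@tnorm_trans _ _ _ _ n j0) ?nJ // -/w' -zE tnormM tnormV /Y -/j0.
  by rewrite mulrC divfK // tnorm_neq0.
have YU n m : in_layer n (Y n m) /\ is_p_unit p (Y n m).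
  have [wj Uwj _] := wP (J n m).
  by split; [apply: in_layer_tnorm | apply: p_unit_tnorm].
have cancel_eq a b z z' m : b != 0 -> is_p_unit p a -> a = b * z ^+ (p ^ m) ->
   forall c, a = c * z' ^+ (p ^ m) -> c = b * (z / z') ^+ (p ^ m).
  move=> b0 [a0 _] aE c acE; have z'0 : z' ^+ (p ^ m) != 0.
    by move: a0; rewrite acE mulf_eq0 negb_or => /andP[].
  by rewrite expr_div_n mulrA -aE acE mulfK.
have [||v vP] := @represents_family p F T gamma p_pr top_gen Y YU.
- move=> n m; pose j := maxn (J n m) (J n m.+1).
  have [z zn zE] := stable n m j (leq_maxl _ _).
  have [z' z'n z'E] := stable n m.+1 j (leq_maxr _ _).
  exists (z / z' ^+ p); first by apply: in_layerM => //; apply/in_layerV/in_layerX.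
  have [_ Uwj _] := wP j.
  apply: (cancel_eq _ _ _ _ _ _ (p_unit_tnorm gamma n j Uwj) zE).
    by have [_ []] := YU n m.
  by rewrite z'E -exprM -expnS.
- move=> n m; pose j := maxn (J n m) (J n.+1 m).
  have [z zn zE] := stable n m j (leq_maxl _ _).
  have [z' z'n z'E] := stable n.+1 m j (leq_maxr _ _).
  have z'N : in_layer n (tnorm gamma n n.+1 z') by apply: in_layer_tnorm.
  exists (z / tnorm gamma n n.+1 z'); first by apply: in_layerM => //; apply: in_layerV.
  have [_ Uwj _] := wP j.
  apply: (cancel_eq _ _ _ _ _ _ (p_unit_tnorm gamma n j Uwj) zE).
    by have [_ []] := YU n m.
  have n1j : (n.+1 <= j)%N := leq_trans (nJ _ _) (leq_maxr _ _).
  by rewrite -(@tnorm_trans _ _ _ _ n n.+1) // z'E tnormM tnormX.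
exists v; apply: (represents_ext (T := T)) => n m.
exists (gamma (Y n m) / Y n m); split; first exact: (represents_gamma gamma).
rewrite /Y -tnorm_gamma -tnormV -tnormM; apply: represents_norm => //.
by have [_ _] := wP (J n m); apply: represents_le; apply: leq_maxr.
Qed.

End Surjectivity.

Theorem theorem2p7 (p : nat) (F : fieldExtType rat) (T : Zp_extension p F)
    (gamma : Gal_inf T) :
  prime p -> odd p -> is_cyclotomic T -> is_top_generator gamma ->
  exists f : {linear barU'_inf T -> barU'_inf0 T},
    bijective f /\
    forall u : barU'_inf T, barU'_inf0_val (f u) = (Lambda_elt gamma - 1) *: u.
Proof.
move=> p_pr _ cyclo top_gen.
have f_mem (u : barU'_inf T) : (Lambda_elt gamma - 1) *: u \in @barU'_inf0_pred p F T.
  by apply/eqP; exact: delta_bottom.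
pose f u : barU'_inf0 T := MkBarU'_inf0 (f_mem u).
have f_lin : linear f.
  move=> a u v; apply: val_inj; rewrite [RHS]linearP; change ((Lambda_elt gamma - 1) *: (a *: u + v) =
    a *: ((Lambda_elt gamma - 1) *: u) + (Lambda_elt gamma - 1) *: v).
  by rewrite scalerDr !scalerA; congr (_ *: _ + _); exact: Lambda_mulC.
pose fL : {linear barU'_inf T -> barU'_inf0 T} := HB.pack f
  (GRing.isLinear.Build (Lambda T) (barU'_inf T) (barU'_inf0 T) *:%R f f_lin).
exists fL; split=> //.
have f_surj (x : barU'_inf0 T) : exists u, f u = x.
  have [u uE] := delta_surj p_pr cyclo top_gen (eqP (valP x)).
  by exists u; apply: val_inj.
have [g gK] := choice f_surj.
exists g => // u; apply/eqP; rewrite -subr_eq0; apply/eqP.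
apply: (delta_inj p_pr top_gen); rewrite scalerBr; apply/eqP; rewrite subr_eq0; apply/eqP.
exact: (congr1 (@barU'_inf0_val p F T) (gK (f u))).
Qed.
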